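(* Let $\lambda$ be a real partition and $r\ge 0$. The map $(w,v)\mapsto\mathrm{INSERT}(w,v)$ is a bijection $$\mathrm{Tab}^\dagger_n(\lambda)\times\mathrm{R}^\dagger_n(r)\;\longrightarrow\;\coprod_{\mu:\ \lambda \text{ interleaves } \mu,\ |\lambda|+r=|\mu|}\mathrm{Tab}^\dagger_n(\mu),$$ where $|\lambda|$ denotes the sum of the parts of $\lambda$ (the length of any timed tableau of shape $\lambda$).
   Context: Let $A_n=\{1,\dots,n\}$ with its usual order. A timed word of length $r\ge 0$ in $A_n$ is a right-continuous piecewise-constant function $w:[0,r)\to A_n$ with finitely many discontinuities; $l(w)=r$. We write $w=c_1^{t_1}\cdots c_k^{t_k}$ ($t_i>0$) if $w$ takes value $c_i$ on $[t_1+\dots+t_{i-1},t_1+\dots+t_i)$; adjacent equal letters may be merged. Concatenation is the product; $\emptyset$ is the empty word. For $0\le a<b\le l(w)$, $w_{[a,b)}(t)=w(a+t)$. A timed row is a weakly increasing timed word; $\mathrm{R}^\dagger_n(r)$ is the set of timed rows in $A_n$ of length $r$. Every timed word has a unique row decomposition $w=u_l\cdots u_1$ into timed rows with $u_iu_{i-1}$ never a row. For timed rows, $u\lhd v$ means $l(u)\ge l(v)$ and $u(t)<v(t)$ for $0\le t<l(v)$. A real partition is a weakly decreasing finite sequence of non-negative reals, equal if they differ by trailing zeros. A timed tableau is a timed word whose row decomposition $u_l\cdots u_1$ satisfies $u_1\lhd\cdots\lhd u_l$; its shape is $(l(u_1),\dots,l(u_l))$; $\mathrm{Tab}^\dagger_n(\lambda)$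 is the set of timed tableaux in $A_n$ of shape $\lambda$. For real partitions $\lambda=(\lambda_1,\dots,\lambda_l)$ and $\mu=(\mu_1,\dots,\mu_{l+1})$ (padding with zeros), ''$\lambda$ interleaves $\mu$'' means $\mu_1\ge\lambda_1\ge\mu_2\ge\lambda_2\ge\dots\ge\lambda_l\ge\mu_{l+1}$. Timed row insertion: for a timed row $u$, a letter $c$ and $t_c\ge0$: if $u(t)\le c$ for all $t$, then $\mathrm{RINS}(u,c^{t_c})=(\emptyset,uc^{t_c})$; otherwise let $t_0=\min\{t: u(t)>c\}$ and set $\mathrm{RINS}(u,c^{t_c})=(u_{[t_0,t_0+t_c)},\,u_{[0,t_0)}c^{t_c}u_{[t_0+t_c,l(u))})$ if $l(u)-t_0>t_c$, and $=(u_{[t_0,l(u))},\,u_{[0,t_0)}c^{t_c})$ if $l(u)-t_0\le t_c$. For a timed row $v=c_1^{t_1}\cdots c_k^{t_k}$: if $(v',u')=\mathrm{RINS}(u,c_1^{t_1}\cdots c_{k-1}^{t_{k-1}})$ and $(v'',u'')=\mathrm{RINS}(u',c_k^{t_k})$, then $\mathrm{RINS}(u,v)=(v'v'',u'')$. Timed tableau insertion: for a timed tableau $w$ with row decomposition $u_l\cdots u_1$ and a timed row $v$, put $v_0'=v$, $(v_i',u_i')=\mathrm{RINS}(u_i,v_{i-1}')$ for $i=1,\dots,l$, and $\mathrm{INSERT}(w,v)=v_l'u_l'\cdots u_1'$. *)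

(* Defs.v *)
From HB Require Import structures.
From mathcomp Require Import all_boot all_order all_algebra.
From mathcomp Require Import all_classical all_reals all_analysis.

Set Implicit Arguments.
Unset Strict Implicit.
Unset Printing Implicit Defensive.

Import Order.TTheory GRing.Theory Num.Theory.
Import numFieldNormedType.Exports.

Local Open Scope classical_set_scope.
Local Open Scope ring_scope.

(* A function [0, wlen) -> {1, ..., n} is extended by the non-letter 0 to the
   whole real line, so that Leibniz equality of words is equality of lengths
   and equality of functions on [0, wlen). *)
Record word (R : realType) := Word { wlen : R; wfun :> R -> nat }.

HB.instance Definition _ (R : realType) := gen_eqMixin (word R).
HB.instance Definition _ (R : realType) := gen_choiceMixin (word R).

(* Limits are taken in nat with its canonical, discrete, topology.  A function
   to a discrete space with finitely many discontinuities is automatically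
   piecewise constant. *)
Definition timed_word (R : realType) (n : nat) (w : word R) : Prop :=
  [/\ 0 <= wlen w,
      forall t, 0 <= t < wlen w -> (1 <= w t <= n)%N,
      forall t, ~~ (0 <= t < wlen w) -> w t = 0%N,
      forall t, 0 <= t < wlen w -> w x @[x --> t^'+] --> w t
    & finite_set [set t | 0 < t < wlen w /\ ~ {for t, continuous (w : R -> nat)}]].

Definition wempty (R : realType) : word R := Word 0 (fun _ => 0%N).

Definition wpow (R : realType) (c : nat) (r : R) : word R :=
  Word r (fun t => if 0 <= t < r then c else 0%N).

Definition wcat (R : realType) (u v : word R) : word R :=
  Word (wlen u + wlen v)
    (fun t => if t < wlen u then u t else v (t - wlen u)).

Definition wprod (R : realType) (s : seq (word R)) : word R :=
  foldr (@wcat R) (wempty R) s.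

Definition wsub (R : realType) (w : word R) (a b : R) : word R :=
  Word (b - a) (fun t => if 0 <= t < b - a then w (a + t) else 0%N).

Definition timed_row (R : realType) (n : nat) (w : word R) : Prop :=
  timed_word n w /\
  forall s t, 0 <= s -> s <= t -> t < wlen w -> (w s <= w t)%N.

Definition timed_rows (R : realType) (n : nat) (r : R) : set (word R) :=
  [set w | timed_row n w /\ wlen w = r].

(* [:: (c_1, t_1); ...; (c_k, t_k)] is the expression of w as
   c_1^{t_1} ... c_k^{t_k} in which equal adjacent letters have been merged. *)
Definition exponential_form (R : realType) (w : word R) (s : seq (nat * R))
    : Prop :=
  [/\ all (fun p => 0 < p.2) s,
      sorted (fun p q => p.1 != q.1) s
    & w = wprod [seq wpow p.1 p.2 | p <- s]].

Definition segments (R : realType) (w : word R) : seq (nat * R) :=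
  xget [::] (exponential_form w).

(* us = [:: u_1; ...; u_l] lists the rows of w = u_l ... u_1 from right to
   left.  The rows are non-empty, so the empty word has no row. *)
Definition row_decomposition (R : realType) (n : nat) (w : word R)
    (us : seq (word R)) : Prop :=
  [/\ forall u, u \in us -> timed_row n u /\ 0 < wlen u,
      forall i, (i.+1 < size us)%N ->
        ~ timed_row n (wcat (nth (wempty R) us i.+1) (nth (wempty R) us i))
    & w = wprod (rev us)].

Definition rows (R : realType) (n : nat) (w : word R) : seq (word R) :=
  xget [::] (row_decomposition n w).

Definition lhd (R : realType) (u v : word R) : Prop :=
  wlen v <= wlen u /\ forall t, 0 <= t < wlen v -> (u t < v t)%N.

Definition timed_tableau (R : realType) (n : nat) (w : word R) : Prop :=
  timed_word n w /\
  forall i, (i.+1 < size (rows n w))%N ->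
    lhd (nth (wempty R) (rows n w) i) (nth (wempty R) (rows n w) i.+1).

Definition shape (R : realType) (n : nat) (w : word R) : seq R :=
  [seq wlen u | u <- rows n w].

Definition real_partition (R : realType) (la : seq R) : Prop :=
  sorted >=%R la /\ all (fun x => 0 <= x) la.

Definition same_partition (R : realType) (la mu : seq R) : Prop :=
  forall i, nth 0 la i = nth 0 mu i.

Definition psum (R : realType) (la : seq R) : R := \sum_(x <- la) x.

(* Indices start at 0; partitions are padded with zeros. *)
Definition interleaves (R : realType) (la mu : seq R) : Prop :=
  forall i, nth 0 mu i.+1 <= nth 0 la i <= nth 0 mu i.

Definition tableaux (R : realType) (n : nat) (la : seq R) : set (word R) :=
  [set w | timed_tableau n w /\ same_partition (shape n w) la].

(* Unions of the sets [tableaux n mu] over real partitions mu (up to trailing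
   zeros) are therefore disjoint unions. *)
Lemma tableaux_disjoint (R : realType) (n : nat) (la mu : seq R) (w : word R) :
  tableaux n la w -> tableaux n mu w -> same_partition la mu.
Proof. by move=> [_ sla] [_ smu] i; rewrite -sla -smu. Qed.

(* The infimum is min {t : u(t) > c}, attained because u is right-continuous. *)
Definition bump_time (R : realType) (u : word R) (c : nat) : R :=
  inf [set t | 0 <= t < wlen u /\ (c < u t)%N].

Definition rins_letter (R : realType) (u : word R) (c : nat) (tc : R)
    : word R * word R :=
  if `[< forall t, 0 <= t < wlen u -> (u t <= c)%N >] then
    (wempty R, wcat u (wpow c tc))
  else
    let t0 := bump_time u c in
    if tc < wlen u - t0 then
      (wsub u t0 (t0 + tc),
       wcat (wcat (wsub u 0 t0) (wpow c tc)) (wsub u (t0 + tc) (wlen u)))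
    else
      (wsub u t0 (wlen u), wcat (wsub u 0 t0) (wpow c tc)).

Definition rins_segments (R : realType) (u : word R) (s : seq (nat * R))
    : word R * word R :=
  foldl (fun vu p => let vu' := rins_letter vu.2 p.1 p.2 in
                     (wcat vu.1 vu'.1, vu'.2))
        (wempty R, u) s.

Definition RINS (R : realType) (u v : word R) : word R * word R :=
  rins_segments u (segments v).

(* [:: u_1; ...; u_l] and v are sent to [:: u'_1; ...; u'_l; v'_l]. *)
Fixpoint insert_rows (R : realType) (us : seq (word R)) (v : word R)
    : seq (word R) :=
  if us is u :: us' then (RINS u v).2 :: insert_rows us' (RINS u v).1
  else [:: v].

Definition INSERT (R : realType) (n : nat) (w v : word R) : word R :=
  wprod (rev (insert_rows (rows n w) v)).

(* Main.v *)
Require Import Defs.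
From mathcomp Require Import all_boot all_order all_algebra.
From mathcomp Require Import all_classical all_reals all_analysis.
From mathcomp Require Import lra zify.
Import Order.TTheory GRing.Theory Num.Theory.
Import numFieldNormedType.Exports.
Local Open Scope classical_set_scope.
Local Open Scope ring_scope.

(* A row is encoded by its cumulative function U, where U(c) is the total length
   of the letters at most c, and a tableau by the Gelfand-Tsetlin pattern P of
   the cumulative functions of its rows.  Inserting a row with cumulative
   function V sends P to a pattern Q given by the piecewise linear local rule
     Q_i(a+1) = max(Q_i(a), P_i(a+1)) + min(Q_{i-1}(a), P_{i-1}(a+1)) - P_{i-1}(a)
   (for i = 0 the last two terms are replaced by V(a+1) - V(a)).  The rule can be
   solved for P_{i-1}(a), hence P and V are recovered from Q and the shape
   P(n), level by level, downwards from n.  All the interlacing conditions are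
   local too, so they are preserved in both directions. *)

(** * Words and their discontinuities *)

(** The local rule is a reflection. With M = max(Q_{i+1}(a), P_{i+1}(a+1)) and m = min(Q_i(a),
    P_i(a+1)) it reads P_i(a) + Q_{i+1}(a+1) = M + m: the two unknowns are mirror images in the
    interval [M, m]. The inequalities between P_i(a) and its neighbours say that it lies in this
    interval, and so do those for Q_{i+1}(a+1); hence interlacing passes in both directions. Such
    reflections are the piecewise linear toggles of Gelfand-Tsetlin patterns. Since lengths are
    real, there is no induction box by box as for ordinary words; the induction runs over the
    alphabet instead. Insertion, however, is defined through an exponential form and a row
    decomposition picked by [xget], so existence has to be proved for both, and uniqueness for the
    row decomposition, before patterns can describe it. *)

Lemma continuous_nat_atP {R : realType} (f : R -> nat) (t : R) :
  {for t, continuous f} <->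
  exists2 e, 0 < e & forall x, `|x - t| < e -> f x = f t.
Proof.
split=> [cf | [e e0 fe]].
  have /nbhs_ballP[e /= e0 be] := cf [set f t] (discrete_set1 (f t)).
  by exists e => // x xe; apply: be; rewrite /ball /= distrC.
move=> A /nbhs_singleton Aft; apply/nbhs_ballP; exists e => //= x.
by rewrite /ball /= distrC => /fe ->.
Qed.

Lemma right_continuous_nat_atP {R : realType} (f : R -> nat) (t : R) :
  (f x @[x --> t^'+] --> f t) <->
  exists2 e, 0 < e & forall x, t < x < t + e -> f x = f t.
Proof.
split=> [cf | [e e0 fe]].
  have /nbhs_ballP[e /= e0 be] := cf [set f t] (discrete_set1 (f t)).
  exists e => // x /andP[tx xe]; apply: be => //; rewrite /ball /=.
  by rewrite ltr_norml; lra.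
move=> A /nbhs_singleton Aft; apply/nbhs_ballP; exists e => //= x.
rewrite /ball /= ltr_norml => xe tx; rewrite fe //; lra.
Qed.

(** The list [s] may contain more than the discontinuities. This slack makes closure under
    concatenation and restriction a matter of linear inequalities. *)
Lemma timed_wordP {R : realType} (n : nat) (w : word R) :
  timed_word n w <->
  [/\ 0 <= wlen w,
      forall t, 0 <= t < wlen w -> (1 <= w t <= n)%N,
      forall t, ~~ (0 <= t < wlen w) -> w t = 0%N,
      forall t, 0 <= t < wlen w ->
        exists2 e, 0 < e & forall x, t < x < t + e -> w x = w t
    & exists s : seq R, forall t, 0 < t < wlen w -> t \notin s ->
        exists2 e, 0 < e & forall x, `|x - t| < e -> w x = w t].
Proof.
split=> [[w0 wn wout wr wd]|[w0 wn wout wr [s ws]]]; split=> //.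
- by move=> t /wr /right_continuous_nat_atP.
- move/finite_seqP: wd => [s sE]; exists s => t tw ts.
  apply/continuous_nat_atP; apply: contrapT => ct.
  have : [set t | 0 < t < wlen w /\ ~ {for t, continuous (w : R -> nat)}] t by [].
  by rewrite sE /= (negPf ts).
- by move=> t /wr /right_continuous_nat_atP.
- apply: (sub_finite_set _ (finite_seq s)) => t [tw ct] /=.
  by apply: contrapT => /negP ts; apply: ct; apply/continuous_nat_atP/ws.
Qed.

Lemma word_eq {R : realType} (u v : word R) :
  wlen u = wlen v -> (forall t, u t = v t) -> u = v.
Proof. by case: u v => a f [b g] /= -> /funext ->. Qed.

Lemma timed_word_empty {R : realType} (n : nat) : timed_word n (wempty R).
Proof.
apply/timed_wordP; split=> //=; [move=> t|move=> t|exists [::] => t];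
  by move=> /andP[h1 h2]; exfalso; lra.
Qed.

Lemma timed_word_cat {R : realType} (n : nat) (u v : word R) :
  timed_word n u -> timed_word n v -> timed_word n (wcat u v).
Proof.
move=> /timed_wordP[u0 un uo ur [su us]] /timed_wordP[v0 vn vo vr [sv vs]].
apply/timed_wordP; split=> /=.
- lra.
- move=> t tuv; case: ifP => tu; first by apply: un; lra.
  by apply: vn; move: tu => /negbT; rewrite -leNgt => tu; lra.
- move=> t; rewrite negb_and -ltNge -leNgt => tuv.
  case: ifPn => [tu|]; first by apply: uo; rewrite negb_and -ltNge -leNgt; lra.
  by rewrite -leNgt => tu; apply: vo; rewrite negb_and -ltNge -leNgt; lra.
- move=> t tuv; case: ifPn => [tu|].
    have /ur[e e0 ue] : 0 <= t < wlen u by lra.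
    exists (Num.min e (wlen u - t)) => [|x xt]; first by rewrite lt_min; lra.
    have : x < t + e /\ x < wlen u.
      by move: xt; case: (leP e) => ? ?; split; lra.
    by move=> [xe xu]; rewrite xu; apply: ue; lra.
  rewrite -leNgt => tu.
  have /vr[e e0 ve] : 0 <= t - wlen u < wlen v by lra.
  exists e => // x xt; rewrite ifF; last by apply: negbTE; rewrite -leNgt; lra.
  by apply: ve; lra.
exists (wlen u :: su ++ [seq wlen u + x | x <- sv]) => t tuv.
rewrite inE mem_cat !negb_or => /and3P[tnu tsu tsv].
case: ifPn => [tu|].
  have /us[//|e e0 ue] : 0 < t < wlen u by lra.
  exists (Num.min e (wlen u - t)) => [|x]; first by rewrite lt_min; lra.
  rewrite lt_min => /andP[xe]; rewrite ltr_norml => xu.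
  by rewrite ifT; [exact: ue | lra].
rewrite -leNgt => tu; have {}tu : wlen u < t by rewrite lt_neqAle eq_sym tnu.
have /vs[|e e0 ve] : 0 < t - wlen u < wlen v by lra.
  apply: contra tsv => ?; apply/mapP; exists (t - wlen u) => //; lra.
exists (Num.min e (t - wlen u)) => [|x]; first by rewrite lt_min; lra.
rewrite lt_min => /andP[xe]; rewrite ltr_norml => xu.
rewrite ifF; last by apply: negbTE; rewrite -leNgt; lra.
by apply: ve; rewrite [X in `|X|](_ : _ = x - t) //; lra.
Qed.

Lemma timed_word_sub {R : realType} (n : nat) (w : word R) (a b : R) :
  timed_word n w -> 0 <= a -> a <= b -> b <= wlen w ->
  timed_word n (wsub w a b).
Proof.
move=> /timed_wordP[w0 wn wo wr [s ws]] a0 ab bw.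
apply/timed_wordP; split=> /=.
- lra.
- by move=> t tab; rewrite tab; apply: wn; lra.
- by move=> t /negPf ->.
- move=> t tab; rewrite tab.
  have /wr[e e0 we] : 0 <= a + t < wlen w by lra.
  exists (Num.min e (b - a - t)) => [|x xt]; first by rewrite lt_min; lra.
  have [xe xb] : x < t + e /\ x < b - a.
    by move: xt; case: (leP e) => ? ?; split; lra.
  by rewrite ifT; [apply: we; lra | lra].
exists [seq x - a | x <- s] => t tab ts.
have /ws[|e e0 we] : 0 < a + t < wlen w by lra.
  by apply: contra ts => ?; apply/mapP; exists (a + t) => //; lra.
exists (Num.min e (Num.min t (b - a - t))) => [|x].
  by rewrite !lt_min; lra.
rewrite !lt_min => /and3P[xe]; rewrite !ltr_norml => x1 x2.
rewrite !ifT; [|lra|lra].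
by apply: we; rewrite [X in `|X|](_ : _ = x - t) //; lra.
Qed.

(** * Rows and cumulative functions *)

(* U c is meant to be the total length of the letters at most c in a row. *)
Definition cumulative {R : realType} (n : nat) (U : nat -> R) : Prop :=
  [/\ U 0%N = 0, forall a, U a <= U a.+1
    & forall a, (n <= a)%N -> U a = U n].

(** The last clause is a Galois connection between times and letters: [w t] is the least [c] with
    [t < U c]. Thus [w] and [U] determine each other without any list of segments. *)
Definition is_row {R : realType} (n : nat) (U : nat -> R) (w : word R) : Prop :=
  [/\ cumulative n U, wlen w = U n,
      forall t, ~~ (0 <= t < U n) -> w t = 0%N
    & forall t c, 0 <= t < U n -> (w t <= c)%N = (t < U c)].

Definition row_of {R : realType} (n : nat) (U : nat -> R) : word R :=
  Word (U n) (fun t =>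
    if 0 <= t < U n then find (fun c => t < U c) (iota 0 n.+1) else 0%N).

Lemma cumulative_le {R : realType} {n : nat} {U : nat -> R} {a b : nat} :
  cumulative n U -> (a <= b)%N -> U a <= U b.
Proof.
move=> [_ Uinc _] /subnK <-; elim: (b - a)%N => // k IH.
exact: le_trans IH (Uinc _).
Qed.

Lemma cumulative_ge0 {R : realType} {n : nat} {U : nat -> R} (a : nat) :
  cumulative n U -> 0 <= U a.
Proof. by move=> cU; have [<- _ _] := cU; exact: (cumulative_le cU). Qed.

Lemma cumulative_le_total {R : realType} {n : nat} {U : nat -> R} (a : nat) :
  cumulative n U -> U a <= U n.
Proof.
move=> cU; have [an|na] := leqP a n; first exact: (cumulative_le cU).
by have [_ _ ->] := cU; last exact: ltnW.
Qed.

Lemma is_row_inj {R : realType} {n : nat} {U : nat -> R} {v w : word R} :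
  is_row n U v -> is_row n U w -> v = w.
Proof.
move=> [_ lv ov vE] [_ lw ow wE]; apply: word_eq => [|t]; first by rewrite lv.
have [tU|tU] := boolP (0 <= t < U n); last by rewrite ov // ow.
by apply/eqP; rewrite eqn_leq vE // wE // -wE // leqnn -vE // leqnn.
Qed.

(** If [U a] and [V a] differ, the smaller of the two is a time at which the two Galois connections
    disagree. *)
Lemma is_row_cumulative_inj {R : realType} {n : nat} {U V : nat -> R}
    {w : word R} :
  is_row n U w -> is_row n V w -> forall a, U a = V a.
Proof.
move=> [cU lU oU UE] [cV lV oV VE] a.
have UV : U n = V n by rewrite -lU.
have key t : 0 <= t < U n -> (t < U a) = (t < V a).
  by move=> tU; rewrite -UE // -VE // -UV.
have := cumulative_le_total a cU; have := cumulative_le_total a cV.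
have := cumulative_ge0 a cU; have := cumulative_ge0 a cV.
have [lt|lt|//] := ltgtP (U a) (V a) => *.
- have := key (U a); rewrite lt ltxx => h; have : false = true by apply: h; lra.
  by [].
- have := key (V a); rewrite lt ltxx => h; have : true = false by apply: h; lra.
  by [].
Qed.

Lemma is_row_row_of {R : realType} {n : nat} {U : nat -> R} :
  cumulative n U -> is_row n U (row_of n U).
Proof.
move=> cU; rewrite /row_of.
have [l lE] : exists l, l = iota 0 n.+1 by exists (iota 0 n.+1).
rewrite -lE.
split=> //= [t /negPf -> //|t c tU]; rewrite tU.
have ht : has (fun c => t < U c) l.
  by apply/hasP; exists n; [rewrite lE mem_iota ltnS leqnn | lra].
have fn : (find (fun c => (t < U c)%R) l < n.+1)%N.
  by move: ht; rewrite has_find {2}lE size_iota.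
have := nth_find 0%N ht; rewrite {1}lE nth_iota // add0n => tf.
apply/idP/idP => [fc|tc]; first exact: lt_le_trans tf (cumulative_le cU fc).
rewrite leqNgt; apply/negP => cf.
have := before_find 0%N cf.
by rewrite {1}lE nth_iota ?add0n ?tc //; apply: ltn_trans fn.
Qed.

Lemma is_row_timed_row {R : realType} {n : nat} {U : nat -> R} {w : word R} :
  is_row n U w -> timed_row n w.
Proof.
move=> [cU lU oU UE]; have [U0 _ _] := cU.
have wmono s t : 0 <= s -> s <= t -> t < U n -> (w s <= w t)%N.
  move=> s0 st tU; rewrite UE; last by lra.
  by apply: (le_lt_trans st); rewrite -UE ?leqnn //; lra.
have wltr t : 0 <= t < U n -> t < U (w t) by move=> tU; rewrite -UE.
split; last by move=> s t; rewrite lU; exact: wmono.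
have Un0 := cumulative_ge0 n cU.
apply/timed_wordP; rewrite lU; split=> //.
- move=> t tU; rewrite UE // lt0n -leqn0 UE // U0 -leNgt.
  by have := tU; lra.
- move=> t tU; have := wltr _ tU; exists (U (w t) - t); first lra.
  move=> x xt; have := cumulative_le_total (w t) cU => ?.
  apply/eqP; rewrite eqn_leq; apply/andP.
  by split; [rewrite UE; lra | apply: wmono; lra].
(* The letter changes only at values of [U]: it is constant between [U (w t).-1] and [U (w t)]. *)
exists [seq U c | c <- iota 0 n.+1] => t tU ts.
have tU' : 0 <= t < U n by lra.
have := wltr _ tU' => tw.
have wn : (w t <= n)%N by rewrite UE //; lra.
have w0 : (0 < w t)%N by rewrite lt0n -leqn0 UE // U0 -leNgt; lra.
have wt : U (w t).-1 < t.
  rewrite lt_neqAle; apply/andP; split.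
    apply: contra ts => /eqP <-; apply: map_f.
    by rewrite mem_iota /= add0n ltnS (leq_trans (leq_pred _)).
  by rewrite leNgt -UE // -ltnNge prednK.
have := cumulative_le_total (w t) cU; have := cumulative_ge0 (w t).-1 cU => ? ?.
exists (Num.min (U (w t) - t) (t - U (w t).-1)) => [|x].
  by rewrite lt_min; lra.
rewrite lt_min !ltr_norml => xt.
have xU : 0 <= x < U n by lra.
apply/eqP; rewrite eqn_leq UE //; apply/andP; split; first lra.
by rewrite -[X in (X <= _)%N](prednK w0) ltnNge UE // -leNgt; lra.
Qed.

Lemma timed_row_is_row {R : realType} {n : nat} {w : word R} :
  timed_row n w -> exists U, is_row n U w.
Proof.
move=> [/timed_wordP[w0 wn wo wr _] wm].
pose S c := [set t | 0 <= t < wlen w /\ (c < w t)%N].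
(* The infimum of the empty set is 0, whereas a letter that is never exceeded needs the value
   [wlen w]. *)
pose U c := if `[< S c !=set0 >] then inf (S c) else wlen w.
have lbS c : lbound (S c) 0 by move=> t [/andP[]].
have Uw c : 0 <= U c <= wlen w.
  rewrite /U; case: asboolP => [Sc|_]; last by rewrite lexx w0.
  apply/andP; split; first exact: lb_le_inf.
  have [t St] := Sc; apply: (@le_trans _ _ t); last by case: St; lra.
  by apply: ge_inf => //; exists 0.
have key t c : 0 <= t < wlen w -> (w t <= c)%N = (t < U c).
  move=> tw; rewrite /U; case: asboolP => [Sc|Sc]; last first.
    rewrite (andP tw).2 leqNgt; apply/negP => ct; apply: Sc.
    by exists t; split.
  have hS : has_inf (S c) by split=> //; exists 0.
  have [lt|ge] := ltP t (inf (S c)).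
    rewrite leqNgt; apply/negP => ct.
    have : inf (S c) <= t by apply: ge_inf; [exists 0|split].
    by lra.
  apply/negbTE; rewrite -ltnNge.
  have i0 : 0 <= inf (S c) by exact: lb_le_inf.
  apply: (@leq_trans (w (inf (S c)))); last by apply: wm; lra.
  (* Right continuity shows that the letter at the infimum already exceeds [c]. *)
  have [|e e0 we] := wr (inf (S c)); first by lra.
  have [x [xw cx] xi] := inf_adherent e0 hS.
  have : inf (S c) <= x by apply: ge_inf; [exists 0|split].
  rewrite le_eqVlt => /orP[/eqP -> //|ix].
  by rewrite -(we x) //; lra.
have Un c : (n <= c)%N -> U c = wlen w.
  move=> nc; rewrite /U; case: asboolP => // -[t [tw ct]].
  have /andP[_ wtn] := wn _ tw.
  by have := leq_trans ct (leq_trans wtn nc); rewrite ltnn.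
exists U; split; [|by rewrite Un|by rewrite Un|by rewrite Un // => t c; exact: key].
split=> [|a|a na]; last by rewrite !Un.
- apply/eqP; rewrite eq_le; have := Uw 0%N => Uw0; apply/andP; split; last lra.
  rewrite leNgt; apply/negP => U0; have h : 0 <= (0 : R) < wlen w by lra.
  by have := wn _ h; rewrite lt0n -leqn0 key // U0.
- rewrite leNgt; apply/negP => Ua; have := Uw a; have := Uw a.+1 => ? ?.
  have h : 0 <= U a.+1 < wlen w by lra.
  have := key _ a h; rewrite Ua => /leqW; rewrite key //; lra.
Qed.

Lemma bump_time_is_row {R : realType} {n : nat} {U : nat -> R} {w : word R}
    (c : nat) :
  is_row n U w -> U c < U n -> bump_time w c = U c.
Proof.
move=> [cU lU _ UE] cn; have Uc0 := cumulative_ge0 c cU.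
have mem t : (0 <= t < wlen w /\ (c < w t)%N) <-> U c <= t < U n.
  rewrite lU; split=> [[tw]|tw]; first by rewrite ltnNge UE // -leNgt; lra.
  by split; [lra|rewrite ltnNge UE -?leNgt; lra].
rewrite /bump_time; apply/eqP; rewrite eq_le; apply/andP; split.
  by apply: ge_inf; [exists 0 => t [/andP[]]|apply/mem; lra].
apply: lb_le_inf; first by exists (U c); apply/mem; lra.
by move=> t /mem /andP[].
Qed.

Lemma max_ind {R : realType} (P : R -> Prop) (a b : R) :
  (a <= b -> P b) -> (b < a -> P a) -> P (Num.max a b).
Proof. by case: leP => h hl hg; auto. Qed.

Lemma min_ind {R : realType} (P : R -> Prop) (a b : R) :
  (a <= b -> P a) -> (b < a -> P b) -> P (Num.min a b).
Proof. by case: leP => h hl hg; auto. Qed.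

(** Only the extrema in the goal are split, and quantified hypotheses are dropped; instances of them
    are pushed into the goal beforehand. *)
Ltac lra_minmax :=
  repeat match goal with
  | H : forall _, _ |- _ => clear H
  | H : is_row _ _ _ |- _ => clear H
  | H : cumulative _ _ |- _ => clear H
  end;
  repeat match goal with
  | |- context [@Order.max ?d ?T ?a ?b] =>
      pattern (@Order.max d T a b); apply max_ind; intro
  end;
  repeat match goal with
  | |- context [@Order.min ?d ?T ?a ?b] =>
      pattern (@Order.min d T a b); apply min_ind; intro
  end; lra.

Lemma is_row_ext {R : realType} {n : nat} {U V : nat -> R} {w : word R} :
  (forall a, U a = V a) -> is_row n U w -> is_row n V w.
Proof. by move=> /funext ->. Qed.

Lemma is_row_cumulative {R : realType} {n : nat} {U : nat -> R} {w : word R} :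
  is_row n U w -> cumulative n U.
Proof. by case. Qed.

Lemma is_row_empty {R : realType} (n : nat) : is_row n (fun _ => 0) (wempty R).
Proof.
split=> //= t c.
by move=> /andP[? ?]; exfalso; lra.
Qed.

Lemma is_row_pow {R : realType} (n c : nat) (r : R) :
  (1 <= c <= n)%N -> 0 <= r ->
  is_row n (fun a => if (a < c)%N then 0 else r) (wpow c r).
Proof.
move=> /andP[c0 cn] r0.
have nc : (n < c)%N = false by apply/negbTE; rewrite -leqNgt.
split=> [||t|t a] /=; rewrite ?nc //.
- split=> [|a|a na]; first by rewrite c0.
    case: ltnP => ac; case: ltnP => ac' //.
    by have := leq_ltn_trans ac (ltnW ac'); rewrite ltnn.
  by rewrite nc ltnNge (leq_trans cn na).
- by move=> /negPf ->.
- by move=> tr; rewrite tr; case: ltnP => _; lra.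
Qed.

(** The last hypothesis says that no letter of [u] exceeds a letter of [v]: as soon as [v] has
    letters at most [a], all of [u] is at most [a]. *)
Lemma is_row_cat {R : realType} {n : nat} {U V : nat -> R} {u v : word R} :
  is_row n U u -> is_row n V v -> (forall a, V a = 0 \/ U a = U n) ->
  is_row n (fun a => U a + V a) (wcat u v).
Proof.
move=> [cU lU oU UE] [cV lV oV VE] UV.
have U0 := cumulative_ge0 n cU; have V0 := cumulative_ge0 n cV.
split=> /=.
- case: cU cV => [U00 Ui Ue] [V00 Vi Ve]; split=> [|a|a na].
  + by rewrite U00 V00 addr0.
  + exact: lerD.
  + by rewrite Ue // Ve.
- by rewrite lU lV.
- move=> t; rewrite lU negb_and -ltNge -leNgt => tUV; case: ifPn => [tu|].
    by apply: oU; rewrite negb_and -ltNge -leNgt; lra.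
  by rewrite -leNgt => tu; apply: oV; rewrite negb_and -ltNge -leNgt; lra.
- move=> t a tUV; rewrite lU; have Ua := cumulative_le_total a cU.
  have Va := cumulative_ge0 a cV.
  have [tu|tu] := ltP t (U n); first by rewrite UE; [case: (UV a); lra | lra].
  by rewrite VE; [case: (UV a); lra | lra].
Qed.

Lemma is_row_sub {R : realType} {n : nat} {U : nat -> R} {u : word R} (x y : R) :
  is_row n U u -> 0 <= x -> x <= y -> y <= U n ->
  is_row n (fun a => Num.min y (Num.max x (U a)) - x) (wsub u x y).
Proof.
move=> [cU lU oU UE] x0 xy yU.
have yn : Num.min y (Num.max x (U n)) = y.
  by lra_minmax.
split=> [||t|t a] /=; rewrite ?yn //.
- case: cU => [U0 Ui Ue]; split=> [|a|a na]; last by rewrite Ue.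
    by rewrite U0; lra_minmax.
  by have := Ui a; lra_minmax.
- by move=> /negPf ->.
- move=> tyx; rewrite tyx UE; last lra.
  by lra_minmax.
Qed.

(** The bump time is [U c], and the new letters occupy the interval from [U c] to [U c + t],
    displacing what [u] has there. The extrema treat the three cases of the definition uniformly,
    including an insertion that runs past the end of [u]. *)
Lemma is_row_rins_letter {R : realType} {n : nat} {U : nat -> R} {u : word R}
    (c : nat) (t : R) :
  is_row n U u -> (1 <= c <= n)%N -> 0 <= t ->
  is_row n (fun a => if (a < c)%N then 0 else Num.min (U a - U c) t)
    (rins_letter u c t).1 /\
  is_row n (fun a => if (a < c)%N then U a else Num.max (U c + t) (U a))
    (rins_letter u c t).2.
Proof.
move=> ru cn t0; have [cU lU oU UE] := ru; rewrite /rins_letter.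
have Uc0 := cumulative_ge0 c cU; have Ucn := cumulative_le_total c cU.
have rp := is_row_pow n c t cn t0.
have Ule a := cumulative_le_total a cU; have Uge a := cumulative_ge0 a cU.
have cle a : (a < c)%N -> U a <= U c.
  by move=> ac; apply: (cumulative_le cU); exact: ltnW.
have cge a : (a < c)%N = false -> U c <= U a.
  by move=> ac; apply: (cumulative_le cU); rewrite leqNgt ac.
case: asboolP => [uc|uc] /=.
  have UcE : U c = U n.
    apply/eqP; rewrite eq_le Ucn /= leNgt; apply/negP => lt.
    have : (u (U c) <= c)%N by apply: uc; rewrite lU; lra.
    by rewrite UE; lra.
  have Uan a : (a < c)%N = false -> U a = U n.
    by move=> /cge; have := Ule a; lra.
  split.
    apply: is_row_ext (is_row_empty n) => a; case: ifP => // /Uan ->.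
    by rewrite UcE subrr; lra_minmax.
  apply: is_row_ext (is_row_cat ru rp _) => a /=; last by case: ifP; auto.
  case: ifP => [_|/Uan ->]; first by rewrite addr0.
  by rewrite UcE; lra_minmax.
have {uc}lt : U c < U n.
  rewrite ltNge; apply/negP => Un; apply: uc => x; rewrite lU => xU.
  by rewrite UE //; lra.
have r0 := is_row_sub 0 (U c) ru (lexx _) Uc0 Ucn.
have rp0 : is_row n (fun a => if (a < c)%N then U a else U c + t)
    (wcat (wsub u 0 (U c)) (wpow c t)).
  apply: is_row_ext (is_row_cat r0 rp _) => a /=.
    case: ifP => [/cle|/cge]; have := Uge a; lra_minmax.
  case: ifP => [|/cge]; first by left.
  by right; have := Uge a; lra_minmax.
rewrite (bump_time_is_row c ru lt) lU; case: ifPn => /= [tlt|].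
  split.
    have t1 : U c <= U c + t by lra.
    have t2 : U c + t <= U n by lra.
    apply: is_row_ext (is_row_sub _ _ ru Uc0 t1 t2) => a /=.
    by case: ifP => [/cle|/cge]; lra_minmax.
  have t1 : 0 <= U c + t by lra.
  have t2 : U c + t <= U n by lra.
  apply: is_row_ext (is_row_cat rp0 (is_row_sub _ _ ru t1 t2 (lexx _)) _) => a /=.
    by have := Ule a; case: ifP => [/cle|/cge]; lra_minmax.
  have /andP[_] := cn; rewrite leqNgt => /negPf ->; have := Ule a.
  by case: ifP => [/cle|/cge]; [left; lra_minmax | right].
rewrite -leNgt => tge; split.
  apply: is_row_ext (is_row_sub _ _ ru Uc0 Ucn (lexx _)) => a /=.
  by have := Ule a; case: ifP => [/cle|/cge]; lra_minmax.
apply: is_row_ext rp0 => a /=; have := Ule a.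
by case: ifP => // /cge; lra_minmax.
Qed.

(** * Products of words *)

(** Words are compared by Leibniz equality, so the unit laws of concatenation depend on the values
    outside the domain. *)
Definition proper {R : realType} (w : word R) : Prop :=
  0 <= wlen w /\ forall t, ~~ (0 <= t < wlen w) -> w t = 0%N.

Lemma timed_word_proper {R : realType} {n : nat} {w : word R} :
  timed_word n w -> proper w.
Proof. by case. Qed.

Lemma is_row_timed_word {R : realType} {n : nat} {U : nat -> R} {w : word R} :
  is_row n U w -> timed_word n w.
Proof. by move=> /is_row_timed_row[]. Qed.

Lemma wcatA {R : realType} (u v w : word R) :
  0 <= wlen v -> wcat u (wcat v w) = wcat (wcat u v) w.
Proof.
move=> v0; apply: word_eq => /= [|t]; first by rewrite addrA.
have [tu|tu] := ltP t (wlen u); first by rewrite ifT //; lra.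
rewrite -[in RHS]ltrBlDl; case: ifP => // _.
by congr (w _); lra.
Qed.

Lemma wcat0w {R : realType} (w : word R) : proper w -> wcat (wempty R) w = w.
Proof.
move=> [w0 wo]; apply: word_eq => /= [|t]; first by rewrite add0r.
by rewrite subr0; case: ifP => // t0; rewrite wo // negb_and -ltNge t0.
Qed.

Lemma wcatw0 {R : realType} (w : word R) : proper w -> wcat w (wempty R) = w.
Proof.
move=> [w0 wo]; apply: word_eq => /= [|t]; first by rewrite addr0.
by case: ifP => // tw; rewrite wo // negb_and tw orbT.
Qed.

Lemma proper_cat {R : realType} {u v : word R} :
  proper u -> proper v -> proper (wcat u v).
Proof.
move=> [u0 uo] [v0 vo]; split=> /= [|t]; first lra.
rewrite negb_and -ltNge -leNgt => tuv; case: ifPn => [tu|].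
  by apply: uo; rewrite negb_and -ltNge -leNgt; lra.
by rewrite -leNgt => tu; apply: vo; rewrite negb_and -ltNge -leNgt; lra.
Qed.

Lemma proper_pow {R : realType} (c : nat) (r : R) : 0 <= r -> proper (wpow c r).
Proof. by move=> r0; split=> //= t /negPf ->. Qed.

Lemma wprod_cat {R : realType} (s1 s2 : seq (word R)) :
  (forall u, u \in s1 ++ s2 -> proper u) ->
  proper (wprod s1) /\ wprod (s1 ++ s2) = wcat (wprod s1) (wprod s2).
Proof.
have e : proper (wempty R) by split=> //= t; rewrite lexx.
have pr s : (forall u, u \in s -> proper u) -> proper (wprod s).
  elim: s => //= u s IH ps; apply: proper_cat; first by apply: ps; rewrite mem_head.
  by apply: IH => v vs; apply: ps; rewrite in_cons vs orbT.
elim: s1 => /= [|u s1 IH] ps; first by rewrite wcat0w //; exact: pr.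
have [|p1 ->] := IH; first by move=> v vs; apply: ps; rewrite in_cons vs orbT.
have pu : proper u by apply: ps; rewrite mem_head.
by split; [exact: proper_cat | rewrite wcatA //; case: p1].
Qed.

Lemma wprod_proper {R : realType} (s : seq (word R)) :
  (forall u, u \in s -> proper u) -> proper (wprod s).
Proof. by move=> ps; have [] := @wprod_cat _ s [::]; rewrite ?cats0. Qed.

Lemma wpowD {R : realType} (c : nat) (r s : R) :
  0 <= r -> 0 <= s -> wcat (wpow c r) (wpow c s) = wpow c (r + s).
Proof.
move=> r0 s0; apply: word_eq => //= t.
have [tr|tr] := ltP t r.
  rewrite andbT (_ : (0 <= t < r + s) = (0 <= t)) //.
  by apply/idP/idP; lra.
rewrite (_ : (0 <= t - r < s) = (0 <= t < r + s)) //.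
by apply/idP/idP; lra.
Qed.

Definition wexp {R : realType} (s : seq (nat * R)) : word R :=
  wprod [seq wpow p.1 p.2 | p <- s].

Lemma wexp_proper {R : realType} (s : seq (nat * R)) :
  all (fun p => 0 < p.2) s -> proper (wexp s).
Proof.
move=> /allP ps; apply: wprod_proper => _ /mapP[p /ps p0 ->].
by apply: proper_pow; exact: ltW.
Qed.

Definition letters_in {R : realType} (n : nat) (s : seq (nat * R)) : bool :=
  all (fun p => (1 <= p.1 <= n)%N && (0 < p.2)) s.

Lemma letters_in_gt0 {R : realType} {n : nat} {s : seq (nat * R)} :
  letters_in n s -> all (fun p => 0 < p.2) s.
Proof. by apply: sub_all => p /andP[]. Qed.

Lemma wcat_wsub {R : realType} (w : word R) (d : R) :
  proper w -> 0 <= d -> d <= wlen w ->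
  w = wcat (wsub w 0 d) (wsub w d (wlen w)).
Proof.
move=> [w0 wo] d0 dw; apply: word_eq => /= [|t]; first lra.
rewrite subr0 add0r.
have [td|td] := ltP t d.
  rewrite andbT; case: ifPn => // t0.
  by rewrite wo // negb_and t0.
case: ifPn => [_|h]; first by congr (w _); lra.
apply: wo; apply: contra h; lra.
Qed.

(** Connectedness of an interval: at the infimum of the times with another letter, local constancy
    carries the letter [w 0] from the left to the infimum, and right continuity carries it beyond, a
    contradiction. *)
Lemma constant_word {R : realType} (n : nat) (w : word R) :
  timed_word n w ->
  (forall t, 0 < t < wlen w ->
     exists2 e, 0 < e & forall x, `|x - t| < e -> w x = w t) ->
  w = wpow (w 0) (wlen w).
Proof.
move=> /timed_wordP[w0 wn wo wr _] wc; apply: word_eq => //= t.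
case: ifPn => [tw|]; last exact: wo.
apply: contrapT => tn.
pose S := [set x | 0 <= x < wlen w /\ w x <> w 0].
have lb : lbound S 0 by move=> x [/andP[]].
have hS : has_inf S by split; [exists t|exists 0].
have i0 : 0 <= inf S by apply: lb_le_inf => //; case: hS.
have ge x : S x -> inf S <= x by apply: ge_inf; exists 0.
have it : inf S <= t by apply: ge.
have below x : 0 <= x < inf S -> w x = w 0.
  move=> xi; apply: contrapT => xn.
  by have : inf S <= x by [apply: ge; split=> //; lra]; lra.
have wi : w (inf S) = w 0.
  have [->//|i0'] := eqVneq (inf S) 0.
  have {i0 i0'}i0 : 0 < inf S by rewrite lt_neqAle eq_sym i0'.
  have [|e e0 we] := wc (inf S); first lra.
  (* The two bounds keep [x] at a non-negative time and within [e] of the infimum. *)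
  pose x := Num.max (inf S / 2) (inf S - e / 2).
  have [x1 x2] : 0 <= x < inf S /\ inf S - e < x.
    by rewrite /x; case: (leP (inf S / 2)) => ?; split; lra.
  by rewrite -(we x) ?below // ltr_norml; lra.
have [|e e0 we] := wr (inf S); first lra.
have [x [xw cx] xi] := inf_adherent e0 hS.
have := ge x (conj xw cx); rewrite le_eqVlt => /orP[/eqP ix|ix].
  by apply: cx; rewrite -ix.
by apply: cx; rewrite we ?wi //; lra.
Qed.

(** Induction on the length of a list of possible discontinuities: cutting at one of them turns it
    into an endpoint, so both halves need only the others. *)
Lemma timed_word_wexp {R : realType} {n : nat} {w : word R} :
  timed_word n w ->
  exists2 s, w = wexp s & letters_in n s.
Proof.
move=> tw; have [_ _ _ _ [ds]] := (timed_wordP n w).1 tw.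
have [k] := ubnP (size ds); elim: k => // k IH in w ds tw *.
case: ds => [_|d ds /= kds] wds.
  have w0 : 0 <= wlen w by case: tw.
  have wE : w = wpow (w 0) (wlen w).
    by apply: (constant_word _ _ tw) => t tw'; exact: wds.
  have [l0|l0] := eqVneq (wlen w) 0.
    exists [::] => //; apply: word_eq => //= t; have [_ _ -> //] := tw.
    by rewrite l0; apply/negP => ?; lra.
  exists [:: (w 0, wlen w)]; last first.
    have l1 : 0 < wlen w by rewrite lt_neqAle eq_sym l0 w0.
    by case: tw => _ wn _ _ _; rewrite /= l1 wn ?lexx ?l1.
  rewrite /wexp /= wcatw0 // {1}wE //.
  exact: proper_pow.
have [dw|dw] := boolP (0 < d < wlen w); last first.
  apply: (IH w ds) => // t tw' tds; apply: wds => //.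
  by rewrite in_cons negb_or tds andbT; apply: contraNneq dw => <-.
have pw := timed_word_proper tw.
have t1 : timed_word n (wsub w 0 d) by apply: timed_word_sub => //; lra.
have t2 : timed_word n (wsub w d (wlen w)) by apply: timed_word_sub => //; lra.
have [||s1 E1 p1] := IH _ ds t1; first by [].
  move=> /= t td tds; have [||e e0 we] := wds t; first lra.
    by rewrite in_cons negb_or tds andbT; apply/negP => /eqP ?; lra.
  exists (Num.min e (Num.min t (d - t))) => [|x]; first by rewrite !lt_min; lra.
  rewrite !lt_min => /and3P[xe]; rewrite !ltr_norml => x1 x2.
  by rewrite !ifT ?add0r; [exact: we | lra | lra].
have [||s2 E2 p2] := IH _ [seq x - d | x <- ds] t2; first by rewrite size_map.
  move=> /= t td tds; have [||e e0 we] := wds (d + t); first lra.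
    rewrite in_cons negb_or; apply/andP; split; first by apply/negP => /eqP ?; lra.
    by apply: contra tds => ?; apply/mapP; exists (d + t) => //; lra.
  exists (Num.min e (Num.min t (wlen w - d - t))) => [|x].
    by rewrite !lt_min; lra.
  rewrite !lt_min => /and3P[xe]; rewrite !ltr_norml => x1 x2.
  rewrite !ifT; [|lra|lra].
  by apply: we; rewrite [X in `|X|](_ : _ = x - t) //; lra.
exists (s1 ++ s2); last by rewrite /letters_in all_cat; apply/andP.
rewrite (wcat_wsub w d pw) ?E1 ?E2; [|lra|lra].
rewrite /wexp map_cat.
have [|_ ->//] :=
  wprod_cat [seq wpow p.1 p.2 | p <- s1] [seq wpow p.1 p.2 | p <- s2].
move=> u; rewrite -map_cat => /mapP[p]; rewrite mem_cat => ps ->.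
apply: proper_pow; apply: ltW.
by move: ps => /orP[]; [move/allP: p1 => h /h | move/allP: p2 => h /h] => /andP[].
Qed.

Lemma exponential_form_exists {R : realType} {n : nat} {w : word R} :
  timed_word n w -> exists s, exponential_form w s.
Proof.
move=> /timed_word_wexp[s -> /letters_in_gt0];
elim: s => [_|[c t] s IH /= /andP[/= t0 /IH]].
  by exists [::]; split.
move=> [[|[d r] s'] [/= p' so' E]].
  by exists [:: (c, t)]; split; rewrite /= ?t0 //; rewrite -E.
have [cd|cd] := eqVneq c d; last first.
  exists [:: (c, t), (d, r) & s']; split; rewrite /= ?t0 ?cd //.
  by rewrite -E.
move: p' => /andP[r0 p'].
exists ((d, t + r) :: s'); split=> [||].
- by rewrite /= p' andbT; lra.
- by move: so'; case: (s').
change (wcat (wpow c t) (wexp s) = wcat (wpow d (t + r)) (wexp s')).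
rewrite (E : wexp s = wcat (wpow d r) (wexp s')) cd wcatA /=; last exact: ltW.
by rewrite wpowD //; exact: ltW.
Qed.

(** * Row insertion *)

(* inserted U V and bumped U V are the cumulative functions of u' and v' in
   (v', u') = RINS(u, v); inserted U V satisfies a recursion like that of the
   departure times in a queue. *)
Fixpoint inserted {R : realType} (U V : nat -> R) (a : nat) : R :=
  if a is b.+1 then Num.max (inserted U V b) (U a) + (V a - V b) else 0.

Definition bumped {R : realType} (U V : nat -> R) (a : nat) : R :=
  U a + V a - inserted U V a.

(** When [wexp s] is a row, this is its cumulative function. *)
Definition weight {R : realType} (s : seq (nat * R)) (a : nat) : R :=
  \sum_(p <- s | (p.1 <= a)%N) p.2.

Lemma weight_le {R : realType} {n : nat} {s : seq (nat * R)} (a b : nat) :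
  letters_in n s -> (a <= b)%N -> weight s a <= weight s b.
Proof.
move=> + ab; rewrite /weight; elim: s => [|p s IH /= /andP[/andP[_ p0] /IH]].
  by rewrite !big_nil.
rewrite !big_cons; case: ifP => [pa|_]; first by rewrite (leq_trans pa ab); lra.
by case: ifP; lra.
Qed.

Lemma weight0 {R : realType} {n : nat} {s : seq (nat * R)} :
  letters_in n s -> weight s 0 = 0.
Proof.
move=> /allP sn; rewrite /weight big_seq_cond big_pred0 // => p.
by apply/negP => /andP[/sn /andP[/andP[p0 _] _]]; rewrite leqNgt p0.
Qed.

Lemma weight_all {R : realType} {s : seq (nat * R)} (b a : nat) :
  all (fun p => (p.1 <= b)%N) s -> (b <= a)%N -> weight s a = weight s b.
Proof.
move=> /allP sb ba; rewrite /weight big_seq_cond [RHS]big_seq_cond.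
apply: eq_bigl => p; case ps: (p \in s) => //=.
by have /= h := sb _ ps; rewrite h (leq_trans h ba).
Qed.

Lemma cumulative_weight {R : realType} {n : nat} {s : seq (nat * R)} :
  letters_in n s -> cumulative n (weight s).
Proof.
move=> sn; split; first exact: weight0 sn.
  by move=> a; apply: (weight_le _ _ sn).
move=> a; apply: weight_all; apply: sub_all sn => p.
by move=> /andP[/andP[]].
Qed.

Lemma weight_rcons {R : realType} (s : seq (nat * R)) (p : nat * R) (a : nat) :
  weight (rcons s p) a = weight s a + (if (p.1 <= a)%N then p.2 else 0).
Proof. by rewrite /weight big_rcons /=; case: ifP; rewrite ?addr0. Qed.

Lemma inserted_ge {R : realType} {n : nat} {U V : nat -> R} (a : nat) :
  cumulative n U -> cumulative n V -> U a <= inserted U V a.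
Proof.
move=> [U0 _ _] [_ Vi _]; case: a => [|a]; first by rewrite U0.
by have := Vi a; rewrite /=; lra_minmax.
Qed.

(** Beyond the last letter [c] of the inserted row nothing new enters, and the recursion only takes
    maxima with the increasing [U]. *)
Lemma inserted_stable {R : realType} {n : nat} {U V : nat -> R} (c a : nat) :
  cumulative n U -> cumulative n V -> (forall b, (c <= b)%N -> V b = V c) ->
  (c <= a)%N -> inserted U V a = Num.max (inserted U V c) (U a).
Proof.
move=> cU cV Vc; elim: a => [|a IH ca].
  by rewrite leqn0 => /eqP ->; rewrite max_l // (inserted_ge _ cU cV).
move: ca; rewrite leq_eqVlt => /orP[/eqP <-|ca].
  by rewrite max_l // (inserted_ge _ cU cV).
have ca' : (c <= a)%N by rewrite -ltnS.
rewrite /= IH // (Vc a.+1 (leqW ca')) (Vc a ca') subrr addr0 -maxA; congr Num.max.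
by rewrite max_r //; case: cU.
Qed.

(** Appending [c^t] changes the recursion exactly as [is_row_rins_letter] changes the row
    [inserted U V]; this is the inductive step for inserting a row segment by segment. *)
Lemma inserted_letter {R : realType} {n : nat} {U V : nat -> R} (c : nat)
    (t : R) (a : nat) :
  cumulative n U -> cumulative n V -> (forall b, (c <= b)%N -> V b = V c) ->
  (1 <= c)%N -> 0 <= t ->
  inserted U (fun b => V b + (if (c <= b)%N then t else 0)) a =
  if (a < c)%N then inserted U V a
  else Num.max (inserted U V c + t) (inserted U V a).
Proof.
move=> cU cV Vc c1 t0; elim: a => [|a IH]; first by rewrite c1.
rewrite [LHS]/= IH; have [ac|] := ltnP a.+1 c.
  by rewrite (ltnW ac) (leqNgt c a) (ltnW ac) /= !addr0.
rewrite leq_eqVlt => /orP[/eqP ca|ca].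
  by rewrite ca ltnSn ltnn [RHS]max_l /=; lra.
have ca' : (c <= a)%N by rewrite -ltnS.
rewrite ltnNge ca' /=.
rewrite (Vc a.+1 (leqW ca')) (Vc a ca') !subrr !addr0.
by rewrite -maxA.
Qed.

Lemma is_row_rins_segments {R : realType} {n : nat} {U : nat -> R}
    {u : word R} (s : seq (nat * R)) :
  is_row n U u -> letters_in n s -> pairwise leq [seq p.1 | p <- s] ->
  is_row n (bumped U (weight s)) (rins_segments u s).1 /\
  is_row n (inserted U (weight s)) (rins_segments u s).2.
Proof.
move=> ru; have cU := is_row_cumulative ru.
elim/last_ind: s => [_ _|s [c t] IH].
  have w0 a : weight [::] a = 0 :> R by rewrite /weight big_nil.
  have i0 a : inserted U (weight [::]) a = U a.
    elim: a => [|a IH] /=; first by case: cU.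
    by rewrite IH !w0 subrr addr0 max_r //; case: cU.
  split; last exact: is_row_ext ru.
  by apply: is_row_ext (is_row_empty n) => a; rewrite /bumped i0 w0; lra.
rewrite /letters_in all_rcons map_rcons pairwise_rcons /=.
move=> /andP[/andP[cn t0] sn] /andP[sc sp].
have {IH}[rv ru'] := IH sn sp.
have cV := cumulative_weight sn.
have {}sc : all (fun p => (p.1 <= c)%N) s.
  by rewrite -(all_map fst (fun d => d <= c)%N).
have Vc b : (c <= b)%N -> weight s b = weight s c by exact: weight_all.
rewrite /rins_segments foldl_rcons -/(rins_segments u s) /=.
have [r1 r2] := is_row_rins_letter c t ru' cn (ltW t0).
have /andP[c1 cn'] := cn.
have wE : weight (rcons s (c, t)) =
    fun b => weight s b + (if (c <= b)%N then t else 0).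
  by apply/funext => b; rewrite weight_rcons.
rewrite wE; split; last first.
  by apply: is_row_ext r2 => a; rewrite (inserted_letter _ _ _ cU cV) // ltW.
apply: is_row_ext (is_row_cat rv r1 _) => a /=.
  rewrite /bumped (inserted_letter _ _ _ cU cV) ?(ltW t0) //.
  by rewrite /= (leqNgt c a); case: (ltnP a c) => /= ac; lra_minmax.
(* The bumped words concatenate to a row: either the new segment bumps no letter at most [a], or
   [inserted] agrees with [U] at [a], and then everything bumped earlier is at most [a]. *)
have [ac|ca] := ltnP a c; first by left.
have Ia := inserted_stable _ _ cU cV Vc ca.
have In := inserted_stable _ _ cU cV Vc cn'.
have Ua := cumulative_le_total a cU.
rewrite /bumped In Ia (Vc a) // (Vc n) //.
by case: (leP (inserted U (weight s) c) (U a)) => h; [right|left]; lra_minmax.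
Qed.

(** [segments] is an arbitrary choice of an expression; for a row every choice has weakly increasing
    letters and the same weights, so the result of insertion does not depend on it. *)
Lemma is_row_wexp {R : realType} {n : nat} {s : seq (nat * R)} {V : nat -> R} :
  all (fun p => 0 < p.2) s -> is_row n V (wexp s) ->
  [/\ letters_in n s, pairwise leq [seq p.1 | p <- s]
    & forall a, V a = weight s a].
Proof.
elim: s V => [|[c t] s IH] V /=.
  move=> _ rV; split=> // a; rewrite /weight big_nil.
  exact: is_row_cumulative_inj rV (is_row_empty n) a.
move=> /andP[t0 sp] rV; have pw := wexp_proper _ sp.
set w := wexp s in pw; change (is_row n V (wcat (wpow c t) w)) in rV.
have [cV lV oV VE] := rV; have [w0 wo] := pw; rewrite /= in lV.
have vc x : 0 <= x < t -> (wcat (wpow c t) w) x = c.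
  by move=> xt; rewrite /= !ifT //; lra.
have cn : (1 <= c <= n)%N.
  have [_ + _ _ _] := is_row_timed_word rV.
  by move=> /(_ 0) /=; rewrite t0 lexx /=; apply; lra.
have Va0 a : (a < c)%N -> V a = 0.
  move=> ac; apply/eqP; rewrite eq_le (cumulative_ge0 _ cV) andbT leNgt.
  apply/negP => Va; move: ac; rewrite -(vc 0) ?lexx ?t0 // ltnNge VE ?Va //.
  by rewrite -lV; lra.
have Vc : t <= V c.
  rewrite leNgt; apply/negP => Vct; have := cumulative_ge0 c cV => Vc0.
  have : ((wcat (wpow c t) w) (V c) <= c)%N by rewrite vc //; lra.
  by rewrite VE ?ltxx // -lV; lra.
have tn : t <= V n by lra.
(* As a restriction of a row, the tail has a known cumulative function, and the induction hypothesis
   applies to it. *)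
have wE : w = wsub (wcat (wpow c t) w) t (V n).
  apply: word_eq => /= [|x]; first lra.
  case: ifPn => [xw|xw]; last by apply: wo; move: xw; rewrite -lV addrC addKr.
  by rewrite ifF; [congr (w _); lra | apply/negbTE; rewrite -leNgt; lra].
have := is_row_sub _ _ rV (ltW t0) tn (lexx _); rewrite -wE => rw.
have [sn pl sE] := IH _ sp rw.
have sE' a : V a = (if (c <= a)%N then t else 0) + weight s a.
  rewrite -sE; have := cumulative_le_total a cV; have [ca|ac] := leqP c a.
    by have := cumulative_le cV ca; lra_minmax.
  by rewrite (Va0 _ ac); lra_minmax.
split; first by rewrite cn t0.
- rewrite pl andbT all_map; apply/allP => -[d r] ds /=.
  rewrite leqNgt; apply/negP => dc.
  have := sE' d; rewrite Va0 // leqNgt dc /= add0r => wd.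
  have /allP/(_ _ ds)/= r0 := sp.
  suff : r <= weight s d by lra.
  rewrite /weight (big_rem _ ds) /= leqnn lerDl big_seq_cond.
  by apply: sumr_ge0 => p /andP[/mem_rem ps _]; have /allP/(_ _ ps)/ltW := sp.
by move=> a; rewrite sE' /weight big_cons /=; case: ifP; rewrite ?add0r.
Qed.

Lemma is_row_RINS {R : realType} {n : nat} {U V : nat -> R} {u v : word R} :
  is_row n U u -> is_row n V v ->
  is_row n (bumped U V) (RINS u v).1 /\ is_row n (inserted U V) (RINS u v).2.
Proof.
move=> ru rv; rewrite /RINS /segments; set s := xget _ _.
have [sp _ vE] : exponential_form v s.
  by apply: xgetPex; apply: exponential_form_exists (is_row_timed_word rv).
have [|sn pl /funext ->] := @is_row_wexp _ n s V sp; first by rewrite /wexp -vE.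
exact: is_row_rins_segments.
Qed.

(** * Row decompositions *)

(** For rows: the last letter of [u] exceeds the first letter of [v]. The domain is half-open, so
    the last letter is not the value at a prescribed time. *)
Definition descent {R : realType} (u v : word R) : Prop :=
  exists2 t, 0 <= t < wlen u & (v 0%R < u t)%N.

Lemma not_timed_row_wcatP {R : realType} {n : nat} {u v : word R} :
  timed_row n u -> timed_row n v -> 0 < wlen v ->
  ~ timed_row n (wcat u v) <-> descent u v.
Proof.
move=> [tu mu] [tv mv] v0; split=> [nuv|[t tu' vu] [_ /(_ t (wlen u))]]; last first.
  rewrite /= ltxx subrr (andP tu').2 leqNgt vu.
  by case/(_ _ _ _)/negP => //; lra.
apply: contrapT => nd; apply: nuv; split=> [|s t s0 st /= tuv].
  exact: timed_word_cat.
have [su|su] := ltP s (wlen u); have [tu'|tu'] := ltP t (wlen u).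
- exact: mu.
- apply: (@leq_trans (v 0)); last by apply: mv; lra.
  by rewrite leqNgt; apply/negP => ?; apply: nd; exists s => //; rewrite s0.
- by exfalso; lra.
- by apply: mv; lra.
Qed.

(** The rows in reading order, opposite to [row_decomposition], so that induction on the list
    follows [wprod]. *)
Definition row_factors {R : realType} (n : nat) (rs : seq (word R)) : Prop :=
  (forall u, u \in rs -> timed_row n u /\ 0 < wlen u) /\
  forall i, (i.+1 < size rs)%N ->
    descent (nth (wempty R) rs i) (nth (wempty R) rs i.+1).

Lemma row_decompositionE {R : realType} (n : nat) (w : word R)
    (us : seq (word R)) :
  row_decomposition n w us <-> row_factors n (rev us) /\ w = wprod (rev us).
Proof.
have nrP i : (i.+1 < size us)%N ->
    (forall u, u \in us -> timed_row n u /\ 0 < wlen u) ->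
    (~ timed_row n (wcat (nth (wempty R) us i.+1) (nth (wempty R) us i))) <->
    descent (nth (wempty R) us i.+1) (nth (wempty R) us i).
  move=> ius rus; have [r1 _] := rus _ (mem_nth (wempty R) ius).
  have [r2 l2] := rus _ (mem_nth (wempty R) (ltnW ius)).
  exact: not_timed_row_wcatP.
split=> [[rus dus ->]|[[rus dus] ->]].
  split=> //; split=> [u|i]; first by rewrite mem_rev; exact: rus.
  rewrite size_rev => ius; rewrite !nth_rev //; last exact: ltnW.
  have -> : (size us - i.+1 = (size us - i.+2).+1)%N by lia.
  by apply/nrP => //; [lia | apply: dus; lia].
have {}rus u : u \in us -> timed_row n u /\ 0 < wlen u.
  by move=> uus; apply: rus; rewrite mem_rev.
split=> // i ius; apply/nrP => //.
have := dus (size us - i.+2)%N; rewrite size_rev !nth_rev; [|lia|lia].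
have -> : (size us - (size us - i.+2).+1 = i.+1)%N by lia.
have -> : (size us - (size us - i.+2).+2 = i)%N by lia.
by apply; lia.
Qed.

Lemma row_factors_cons {R : realType} {n : nat} {u : word R}
    {rs : seq (word R)} :
  row_factors n (u :: rs) ->
  [/\ timed_row n u, 0 < wlen u & row_factors n rs].
Proof.
move=> [ur dr]; have [ru u0] := ur u (mem_head _ _).
split=> //; split=> [v vr|i irs]; first by apply: ur; rewrite in_cons vr orbT.
exact: (dr i.+1).
Qed.

Lemma row_factors_proper {R : realType} {n : nat} {rs : seq (word R)} :
  row_factors n rs -> proper (wprod rs).
Proof.
by move=> [ur _]; apply: wprod_proper => u /ur[[[u0 _ uo _ _] _] _].
Qed.

(** Built from the right, one segment at a time: a segment joins the row after it unless there is a
    descent between them. *)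
Lemma row_factors_exist {R : realType} {n : nat} {w : word R} :
  timed_word n w -> exists2 rs, row_factors n rs & w = wprod rs.
Proof.
move=> /timed_word_wexp[s -> {w}]; elim: s => [_|[c t] s IH].
  by exists [::] => //; split=> // i; rewrite ltn0.
move=> /= /andP[/andP[/= cn t0] /IH[rs frs E]].
have rp := is_row_timed_row (is_row_pow n c t cn (ltW t0)).
have -> : wexp ((c, t) :: s) = wcat (wpow c t) (wprod rs) by rewrite -E.
case: rs frs {E IH} => [_|r rs frs].
  exists [:: wpow c t] => //; split=> [u|[]//].
  by rewrite inE => /eqP ->.
have [rr r0 frs'] := row_factors_cons frs.
have [d|nd] := pselect (descent (wpow c t) r).
  exists [:: wpow c t, r & rs] => //; case: frs => mr dr; split=> [u|[|i] irs //].
    by rewrite in_cons => /orP[/eqP ->//|]; exact: mr.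
  exact: dr.
exists (wcat (wpow c t) r :: rs); last by rewrite /= wcatA // ltW.
have rpr : timed_row n (wcat (wpow c t) r).
  by apply: contrapT; move/not_timed_row_wcatP; auto.
case: frs => mr dr; split=> [u|[|i] irs].
- rewrite in_cons => /orP[/eqP ->|uin]; first by split=> //=; lra.
  by apply: mr; rewrite in_cons uin orbT.
- have [x xr rx] := dr 0%N irs; exists (t + x) => /=; first lra.
  by rewrite ifF; [rewrite addrC addKr|apply/negbTE; rewrite -leNgt; lra].
- exact: (dr i.+1).
Qed.

(** First rows are maximal: a longer [r'] would contain the descent from [r] to the row that follows
    it. *)
Lemma first_row_not_shorter {R : realType} {n : nat} {r r' : word R}
    {rs rs' : seq (word R)} :
  row_factors n (r :: rs) -> row_factors n (r' :: rs') ->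
  wprod (r :: rs) = wprod (r' :: rs') -> wlen r' <= wlen r.
Proof.
move=> f f' E; rewrite leNgt; apply/negP => lt.
have [[tr _] r0 frs] := row_factors_cons f.
have [[tr' mr'] r0' frs'] := row_factors_cons f'.
have [p0 _] := row_factors_proper frs'.
case: rs => [|r2 rs] in f E frs *.
  by have := congr1 (@wlen R) E; rewrite /= addr0; lra.
have [_ r20 frs2] := row_factors_cons frs.
have [t tu rt] := (f.2 0%N isT); move: rt; rewrite /= ltnNge => /negP; apply.
have := congr1 (fun w : word R => w t) E; rewrite /= (andP tu).2 ifT; last lra.
move=> ->; have := congr1 (fun w : word R => w (wlen r)) E.
rewrite /= ltxx subrr r20 lt => ->.
by apply: mr'; lra.
Qed.

Lemma wcat_inj {R : realType} {u v v' : word R} :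
  proper v -> proper v' -> wcat u v = wcat u v' -> v = v'.
Proof.
move=> [v0 vo] [v0' vo'] E; apply: word_eq => [|t].
  by have := congr1 (@wlen R) E => /= /addrI.
have [t0|t0] := ltP t 0.
  by rewrite vo ?vo' // negb_and -ltNge t0.
have := congr1 (fun w : word R => w (t + wlen u)) E.
have h : (t + wlen u < wlen u) = false by apply/negbTE; rewrite -leNgt; lra.
by rewrite /= addrK h.
Qed.

Lemma row_factors_inj {R : realType} {n : nat} {rs rs' : seq (word R)} :
  row_factors n rs -> row_factors n rs' -> wprod rs = wprod rs' -> rs = rs'.
Proof.
elim: rs rs' => [|r rs IH] [|r' rs'] // f f' E.
- have [_ r0 /row_factors_proper[p0 _]] := row_factors_cons f'.
  by exfalso; move/(congr1 (@wlen R)): E => /=; lra.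
- have [_ r0 /row_factors_proper[p0 _]] := row_factors_cons f.
  by exfalso; move/(congr1 (@wlen R)): E => /=; lra.
have lE : wlen r = wlen r'.
  apply/eqP; rewrite eq_le (first_row_not_shorter f f' E).
  by rewrite (first_row_not_shorter f' f (esym E)).
have [[[_ _ ro _ _] _] r0 frs] := row_factors_cons f.
have [[[_ _ ro' _ _] _] r0' frs'] := row_factors_cons f'.
have rE : r = r'.
  apply: word_eq => // t; have [tr|tr] := ltP t (wlen r).
    by have := congr1 (fun w : word R => w t) E; rewrite /= -lE tr.
  by rewrite ro ?ro' // -?lE negb_and -!leNgt tr orbT.
rewrite -rE in E *; congr (_ :: _); apply: IH => //.
exact: (wcat_inj (row_factors_proper frs) (row_factors_proper frs') E).
Qed.

Lemma rows_eq {R : realType} {n : nat} {w : word R} {us : seq (word R)} :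
  row_decomposition n w us -> rows n w = us.
Proof.
move=> h; rewrite /rows; have h' := xgetPex [::] (ex_intro _ us h).
move: h h' => /row_decompositionE[f E] /row_decompositionE[f' E'].
by apply: (can_inj revK); apply: (row_factors_inj f' f); rewrite -E'.
Qed.

Lemma rows_decomposition {R : realType} {n : nat} {w : word R} :
  timed_word n w -> row_decomposition n w (rows n w).
Proof.
move=> /row_factors_exist[rs f E]; apply: xgetPex; exists (rev rs).
by apply/row_decompositionE; rewrite revK.
Qed.

(** * Insertion into patterns *)

(** Rows are indexed by all naturals, absent rows being zero, so insertion never has to change the
    number of rows. *)
Definition pattern {R : realType} (n : nat) (P : nat -> nat -> R) : Prop :=
  (forall i, cumulative n (P i)) /\ forall i a, P i.+1 a.+1 <= P i a.

Fixpoint carried {R : realType} (P : nat -> nat -> R) (V : nat -> R) (i : nat)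
    : nat -> R :=
  if i is j.+1 then bumped (P j) (carried P V j) else V.

Definition insertion {R : realType} (P : nat -> nat -> R) (V : nat -> R)
    (i : nat) : nat -> R :=
  inserted (P i) (carried P V i).

Lemma insertionE0 {R : realType} (P : nat -> nat -> R) (V : nat -> R) (a : nat) :
  insertion P V 0 a.+1 = Num.max (insertion P V 0 a) (P 0%N a.+1) + (V a.+1 - V a).
Proof. by []. Qed.

(** By x + y = max(x, y) + min(x, y); the increment of the incoming word cancels, so the carried
    words disappear from the rule. *)
Lemma carriedB {R : realType} (P : nat -> nat -> R) (V : nat -> R) (i a : nat) :
  carried P V i.+1 a.+1 - carried P V i.+1 a =
  Num.min (insertion P V i a) (P i a.+1) - P i a.
Proof. by rewrite /= /bumped /= -/(insertion P V i a); lra_minmax. Qed.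

(* The piecewise linear local rule, symmetric in [insertion P V] at [a] and
   [P] at [a.+1]; it can be solved for [P i a]. *)
Lemma insertionES {R : realType} (P : nat -> nat -> R) (V : nat -> R) (i a : nat) :
  insertion P V i.+1 a.+1 =
  Num.max (insertion P V i.+1 a) (P i.+1 a.+1) +
  (Num.min (insertion P V i a) (P i a.+1) - P i a).
Proof. by rewrite -carriedB. Qed.

(** Level [n] is the interleaving of the two shapes. The induction needs every level and all rows at
    once, since the rule at [a.+1] refers to level [a] in two adjacent rows. *)
Lemma insertion_interlace {R : realType} {n : nat} {P : nat -> nat -> R}
    {V : nat -> R} (i a : nat) :
  pattern n P -> cumulative n V ->
  insertion P V i.+1 a <= P i a <= insertion P V i a.
Proof.
move=> [cP dP] [_ Vi _]; elim: a i => [|a IH] i.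
  by have [-> _ _] := cP i; rewrite lexx.
have [_ Pi _] := cP i; have := Pi a; have := IH i; have := dP i a.
have lower : P i a.+1 <= insertion P V i a.+1.
  case: i {Pi} => [|i]; first by rewrite insertionE0; have := Vi a; lra_minmax.
  have [_ Pi _] := cP i; rewrite insertionES; have := Pi a; have := IH i.
  by lra_minmax.
by rewrite lower andbT insertionES; lra_minmax.
Qed.

Lemma insertion_pattern {R : realType} {n : nat} {P : nat -> nat -> R}
    {V : nat -> R} :
  pattern n P -> cumulative n V -> pattern n (insertion P V).
Proof.
move=> pP cV; have il i a := insertion_interlace i a pP cV.
case: (pP) (cV) => [cP dP] [_ Vi Ve]; split=> [i|i a]; last first.
  have := il i a; have := il i a.+1; have := dP i a.
  by rewrite insertionES; lra_minmax.
split=> // a.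
  case: i => [|i]; first by rewrite insertionE0; have := Vi a; lra_minmax.
  have [_ Pi _] := cP i; rewrite insertionES; have := Pi a; have := il i a.
  by lra_minmax.
elim: a => [|a IH]; first by rewrite leqn0 => /eqP ->.
rewrite leq_eqVlt ltnS => /orP[/eqP ->//|na]; rewrite -IH //.
case: i {IH} => [|i].
  have [_ _ Pe] := cP 0%N; rewrite insertionE0; have := il 0%N a.
  by rewrite !(Ve a.+1) ?(Ve a) ?(Pe a) ?(Pe a.+1) ?leqW // => ?; lra_minmax.
have [_ _ Pe] := cP i; have [_ _ Pe'] := cP i.+1; rewrite insertionES.
have := il i a; have := il i.+1 a.
by rewrite ?(Pe a) ?(Pe a.+1) ?(Pe' a) ?(Pe' a.+1) ?leqW //; lra_minmax.
Qed.

Lemma cumulative_carried {R : realType} {n : nat} {P : nat -> nat -> R}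
    {V : nat -> R} (i : nat) :
  pattern n P -> cumulative n V -> cumulative n (carried P V i).
Proof.
move=> pP cV; elim: i => [//|i IH].
have [cQ _] := insertion_pattern pP cV; have [Q0 _ Qe] := cQ i.
have [cP _] := pP; have [P0 Pi Pe] := cP i; have [C0 _ Ce] := IH.
split=> [|a|a na]; first by rewrite /= /bumped P0 C0 /=; lra.
  rewrite -subr_ge0 carriedB; have := Pi a; have := insertion_interlace i a pP cV.
  by lra_minmax.
by rewrite /= /bumped (Pe a na) (Ce a na) -!/(insertion P V i _) (Qe a na).
Qed.

(** An empty row absorbs whatever reaches it. Hence the word left over after the last row may be
    viewed as inserted into an empty row. *)
Lemma carried_eq0 {R : realType} {n : nat} {P : nat -> nat -> R}
    {V : nat -> R} (i a : nat) :
  pattern n P -> cumulative n V -> (forall b, P i b = 0) ->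
  carried P V i.+1 a = 0.
Proof.
move=> pP cV Pi; have cC := cumulative_carried i pP cV; rewrite /= /bumped Pi.
suff -> : inserted (P i) (carried P V i) a = carried P V i a by lra.
elim: a => [|a IH] /=; first by case: cC.
by rewrite IH Pi max_l ?(cumulative_ge0 _ cC) //; lra.
Qed.

Lemma sum_insertion {R : realType} (n N : nat) (P : nat -> nat -> R)
    (V : nat -> R) :
  \sum_(i < N) insertion P V i n = \sum_(i < N) P i n + V n - carried P V N n.
Proof.
elim: N => [|N IH]; first by rewrite !big_ord0 /=; lra.
by rewrite !big_ord_recr /= IH /bumped -/(insertion P V N n); lra.
Qed.

Lemma insertion_inj {R : realType} {n : nat} {P P' : nat -> nat -> R}
    {V V' : nat -> R} :
  pattern n P -> cumulative n V -> pattern n P' -> cumulative n V' ->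
  (forall i, P i n = P' i n) ->
  (forall i a, insertion P V i a = insertion P' V' i a) ->
  (forall i a, P i a = P' i a) /\ forall a, V a = V' a.
Proof.
move=> pP cV pP' cV' Pn QE.
(* The rule at [a = n - j.+1] involves level [n - j] of [P] in rows [i] and [i.+1], so all rows are
   treated together. *)
have low i j : (j <= n)%N -> P i (n - j)%N = P' i (n - j)%N.
  elim: j i => [|j IH] i jn; first by rewrite subn0.
  have := insertionES P V i (n - j.+1); have := insertionES P' V' i (n - j.+1).
  by rewrite !QE subnSK // !(IH _ (ltnW jn)); lra.
have PE i a : P i a = P' i a.
  have [an|na] := leqP a n; first by rewrite -(subKn an) low ?leq_subr.
  have [[cP _] [cP' _]] := (pP, pP').
  have [_ _ Pe] := cP i; have [_ _ Pe'] := cP' i.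
  by rewrite (Pe a (ltnW na)) (Pe' a (ltnW na)).
split=> // a; elim: a => [|a IH]; first by have [[-> _ _] [-> _ _]] := (cV, cV').
have := insertionE0 P V a; have := insertionE0 P' V' a.
by rewrite !QE PE IH; lra.
Qed.

(* Level n - j of the pattern P recovered from Q and L = P(n). *)
Fixpoint extracted_level {R : realType} (n : nat) (Q : nat -> nat -> R)
    (L : nat -> R) (j : nat) : nat -> R :=
  if j is k.+1 then fun i =>
    Num.max (Q i.+1 (n - j)%N) (extracted_level n Q L k i.+1) +
    Num.min (Q i (n - j)%N) (extracted_level n Q L k i) - Q i.+1 (n - k)%N
  else L.

(** The bounds on [L] start a downward induction showing that each level of [P] interlaces the same
    level of [Q]; the inequalities of a pattern for [P] then follow from those for [Q]. *)
Lemma insertion_surj {R : realType} {n : nat} {Q : nat -> nat -> R}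
    {L : nat -> R} :
  pattern n Q -> (forall i, Q i.+1 n <= L i <= Q i n) ->
  exists P V, [/\ pattern n P, cumulative n V, forall i, P i n = L i
    & forall i a, insertion P V i a = Q i a].
Proof.
move=> [cQ dQ] QL.
pose P i a := extracted_level n Q L (n - a) i.
have Qi i a : Q i a <= Q i a.+1 by case: (cQ i).
have Qe i a : (n <= a)%N -> Q i a = Q i n by case: (cQ i) => _ _; apply.
have Q0 i : Q i 0 = 0 by case: (cQ i).
have Pe i a : (n <= a)%N -> P i a = L i by rewrite -subn_eq0 /P => /eqP ->.
have PE i a : (a < n)%N -> P i a =
    Num.max (Q i.+1 a) (P i.+1 a.+1) + Num.min (Q i a) (P i a.+1) - Q i.+1 a.+1.
  by move=> an; rewrite {1}/P -subnSK //= subnSK // !subKn // ltnW.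
have il i j : (j <= n)%N -> Q i.+1 (n - j)%N <= P i (n - j)%N <= Q i (n - j)%N.
  elim: j i => [|j IH] i jn; first by rewrite subn0 Pe.
  have jn' : (n - j.+1 < n)%N by rewrite ltn_subrL (leq_ltn_trans _ jn).
  rewrite PE //; have := IH i (ltnW jn); have := IH i.+1 (ltnW jn).
  have := Qi i (n - j.+1)%N; have := Qi i.+1 (n - j.+1)%N.
  have := dQ i (n - j.+1)%N.
  have := dQ i.+1 (n - j.+1)%N.
  by rewrite subnSK //; lra_minmax.
have {}il i a : Q i.+1 a <= P i a <= Q i a.
  have [an|na] := leqP a n; first by rewrite -(subKn an) il ?leq_subr.
  by rewrite !(Qe _ a) ?Pe // ltnW.
(* From level [n] on, [P] and [Q] are constant in [a], and the equation reduces to the interlacing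
   of [L] with level [n] of [Q]. *)
have {}PE i a : P i a =
    Num.max (Q i.+1 a) (P i.+1 a.+1) + Num.min (Q i a) (P i a.+1) - Q i.+1 a.+1.
  have [/PE //|na] := ltnP a n.
  have := il i a; have := il i.+1 a.
  by rewrite !(Qe _ a.+1) ?(Qe _ a) ?(Pe _ a.+1) ?(Pe _ a) ?leqW //; lra_minmax.
have cP i : cumulative n (P i).
  split=> [|a|a na]; last by rewrite !Pe.
    by have := il i 0%N; rewrite !Q0; lra.
  rewrite (PE i a); have := il i.+1 a.+1; have := Qi i.+1 a; lra_minmax.
have pP : pattern n P.
  split=> // i a; rewrite (PE i a); have := il i a.+1; have := dQ i a.
  by lra_minmax.
(* The increments are read off the rule for the first row; they are non-negative because [Q 0 b.+1]
   dominates both arguments of the maximum. *)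
pose V a := \sum_(b < a) (Q 0%N b.+1 - Num.max (Q 0%N b) (P 0%N b.+1)).
have VE a : V a.+1 = V a + (Q 0%N a.+1 - Num.max (Q 0%N a) (P 0%N a.+1)).
  by rewrite /V big_ord_recr.
have cV : cumulative n V.
  split=> [|a|]; first by rewrite /V big_ord0.
    by rewrite VE; have := il 0%N a.+1; have := Qi 0%N a; lra_minmax.
  elim=> [|a IH]; first by rewrite leqn0 => /eqP ->.
  rewrite leq_eqVlt ltnS => /orP[/eqP ->//|na]; rewrite VE IH //.
  have := il 0%N a.
  by rewrite !(Qe _ a.+1) ?(Qe _ a) ?(Pe _ a.+1) ?(Pe _ a) ?leqW //; lra_minmax.
exists P, V; split=> // [i|i a]; first by rewrite Pe.
elim: a i => [|a IH] [|i]; rewrite ?Q0 //.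
  by rewrite insertionE0 IH VE; lra.
by rewrite insertionES !IH (PE i a); lra.
Qed.

(** * Tableaux and patterns *)

Lemma pattern_le_rows {R : realType} {n : nat} {P : nat -> nat -> R} (i j : nat) :
  pattern n P -> (i <= j)%N -> P j n <= P i n.
Proof.
move=> [cP dP] /subnK <-; elim: (j - i)%N => // k IH.
apply: le_trans IH; rewrite addSn.
(* The shift in the letter is harmless at the top level, as the rows are constant from [n] on. *)
by have [_ _ Pe] := cP (k + i).+1; rewrite -(Pe n.+1) //; exact: dP.
Qed.

(** If [U a < V a.+1], then at time [U a] the letter of [v] is at most [a.+1] while that of [u]
    exceeds [a], against strictness. *)
Lemma lhd_is_row {R : realType} {n : nat} {U V : nat -> R} {u v : word R} :
  is_row n U u -> is_row n V v -> lhd u v <-> forall a, V a.+1 <= U a.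
Proof.
move=> [cU lU oU UE] [cV lV oV VE]; rewrite /lhd lU lV; split=> [[VU uv] a|VU].
  rewrite leNgt; apply/negP => lt; have U0 := cumulative_ge0 a cU.
  have Vn := cumulative_le_total a.+1 cV.
  have va : (v (U a) <= a.+1)%N by rewrite VE //; lra.
  have : (u (U a) <= a)%N by rewrite -ltnS (leq_trans (uv _ _) va) //; lra.
  by rewrite UE ?ltxx //; lra.
have VUn : V n <= U n.
  by have [_ _ Ve] := cV; rewrite -(Ve n.+1) //; exact: VU.
split=> // t tV; have := VE t (v t) tV; rewrite leqnn => /esym tv.
case: (v t) tv => [|c] tv; last by rewrite ltnS UE; [have := VU c|]; lra.
by have [V0 _ _] := cV; rewrite V0 in tv; lra.
Qed.

Lemma is_row_eq0 {R : realType} {n : nat} {U : nat -> R} :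
  cumulative n U -> U n = 0 -> forall a, U a = 0.
Proof.
move=> cU Un a; apply/eqP.
by rewrite eq_le (cumulative_ge0 _ cU) -Un (cumulative_le_total _ cU).
Qed.

Definition rows_word {R : realType} (n : nat) (P : nat -> nat -> R) (N : nat) :
  word R := wprod (rev (mkseq (fun i => row_of n (P i)) N)).

(* P encodes w as a Gelfand-Tsetlin pattern: P i a is the total length of the
   letters at most a in row i. *)
Definition tableau_of {R : realType} (n : nat) (P : nat -> nat -> R)
    (w : word R) : Prop :=
  pattern n P /\
  exists2 N, forall i, (N <= i)%N -> P i n = 0 & w = rows_word n P N.

Lemma rows_word_widen {R : realType} {n : nat} {P : nat -> nat -> R}
    (N M : nat) :
  pattern n P -> (forall i, (N <= i)%N -> P i n = 0) -> (N <= M)%N ->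
  rows_word n P M = rows_word n P N.
Proof.
move=> [cP _] P0 /subnK <-; elim: (M - N)%N => // k <-.
have pr i : proper (row_of n (P i)).
  exact: timed_word_proper (is_row_timed_word (is_row_row_of (cP i))).
rewrite /rows_word addSn mkseqS rev_rcons /=.
have -> : row_of n (P (k + N)%N) = wempty R.
  apply: is_row_inj (is_row_row_of (cP _)) _.
  apply: is_row_ext (is_row_empty n) => a.
  by rewrite (is_row_eq0 (cP _)) // P0 // leq_addl.
rewrite wcat0w //; apply: wprod_proper => u.
by rewrite mem_rev => /mapP[i _ ->].
Qed.

Lemma tableau_of_rows {R : realType} {n : nat} {P : nat -> nat -> R}
    {w : word R} :
  tableau_of n P w ->
  exists k, [/\ rows n w = mkseq (fun i => row_of n (P i)) k,
    forall i, (k <= i)%N -> P i n = 0 & timed_tableau n w].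
Proof.
move=> [pP [N P0 wE]]; have [cP dP] := pP.
(* A row decomposition admits no empty row. Row lengths decrease, so the non-empty rows are the
   first [k] ones. *)
have [k kN [Pk0 Pk]] : exists2 k, (k <= N)%N &
    (forall i, (k <= i)%N -> P i n = 0) /\ forall i, (i < k)%N -> 0 < P i n.
  elim: N P0 {wE} => [|N IH] P0; first by exists 0%N.
  have [PN|PN] := eqVneq (P N n) 0.
    have [|k kN kP] := IH; last by exists k => //; exact: leqW.
    by move=> i; rewrite leq_eqVlt => /orP[/eqP <- //|]; exact: P0.
  exists N.+1 => //; split=> // i; rewrite ltnS => /(pattern_le_rows _ _ pP).
  by apply: lt_le_trans; rewrite lt_neqAle eq_sym PN (cumulative_ge0 _ (cP N)).
have {wE} wE : w = rows_word n P k by rewrite wE (rows_word_widen k N).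
have rr i := is_row_row_of (cP i).
have lr i : lhd (row_of n (P i)) (row_of n (P i.+1)).
  by apply/(lhd_is_row (rr i) (rr i.+1)).
have rE : rows n w = mkseq (fun i => row_of n (P i)) k.
  apply: rows_eq; split=> //.
  - move=> u /mapP[i]; rewrite mem_iota /= add0n => ik ->.
    by split; [exact: is_row_timed_row (rr i) | exact: Pk].
  - move=> i; rewrite size_mkseq => ik; rewrite !nth_mkseq //; last exact: ltnW.
    apply/(not_timed_row_wcatP (is_row_timed_row (rr _)) (is_row_timed_row (rr _))).
      exact/Pk/ltnW.
    (* The first column suffices: at time 0 the row [i.+1] has a larger letter than the row [i] that
       follows it in the word. *)
    exists 0; first by rewrite lexx /=; exact: Pk.
    by apply: (lr i).2; rewrite lexx /=; exact: Pk.
exists k; split=> //; split; last first.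
  by rewrite rE size_mkseq => i ik; rewrite !nth_mkseq // ltnW.
have tP : forall s, timed_word n (wprod [seq row_of n (P i) | i <- s]).
  elim=> [|i s IH] /=; first exact: timed_word_empty.
  by apply: timed_word_cat IH; exact: is_row_timed_word (rr i).
by rewrite wE /rows_word /mkseq -map_rev.
Qed.

Lemma nth_shape_tableau_of {R : realType} {n : nat} {P : nat -> nat -> R}
    {w : word R} (i : nat) :
  tableau_of n P w -> nth 0 (Defs.shape n w) i = P i n.
Proof.
move=> /tableau_of_rows[k [rE P0 _]]; rewrite /Defs.shape rE.
have [ik|ki] := ltnP i k.
  by rewrite (nth_map (wempty R)) ?size_mkseq // nth_mkseq.
by rewrite nth_default ?P0 // size_map size_mkseq.
Qed.

Lemma timed_tableau_tableau_of {R : realType} {n : nat} {w : word R} :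
  timed_tableau n w -> exists P, tableau_of n P w.
Proof.
move=> [tw lw]; have [ur _ wE] := rows_decomposition tw.
set us := rows n w in lw ur wE.
have /choice[P rP] : forall i, exists U, is_row n U (nth (wempty R) us i).
  move=> i; have [ius|ius] := ltnP i (size us).
    by have [/timed_row_is_row] := ur _ (mem_nth (wempty R) ius).
  by rewrite nth_default //; exists (fun _ => 0); exact: is_row_empty.
have cP i : cumulative n (P i) by case: (rP i).
have P0 i : (size us <= i)%N -> forall a, P i a = 0.
  move=> ius; have := rP i; rewrite nth_default // => rPi.
  exact: is_row_cumulative_inj rPi (is_row_empty n).
exists P; split.
  split=> // i a; have [ius|ius] := ltnP i.+1 (size us).
    exact: ((lhd_is_row (rP i) (rP i.+1)).1 (lw i ius)).
  by rewrite P0 // (cumulative_ge0 _ (cP i)).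
exists (size us) => [i /P0 -> //|].
rewrite {1}wE /rows_word; congr (wprod (rev _)).
apply: (@eq_from_nth _ (wempty R)); first by rewrite size_mkseq.
move=> i ius; rewrite nth_mkseq //.
exact: is_row_inj (rP i) (is_row_row_of (cP i)).
Qed.

Lemma tableau_of_inj {R : realType} {n : nat} {P : nat -> nat -> R}
    {w w' : word R} :
  tableau_of n P w -> tableau_of n P w' -> w = w'.
Proof.
move=> [pP [N P0 ->]] [_ [N' P0' ->]].
rewrite -(rows_word_widen N (maxn N N')) ?leq_maxl //.
by rewrite -(rows_word_widen N' (maxn N N')) ?leq_maxr.
Qed.

Lemma tableau_of_pattern_inj {R : realType} {n : nat} {P Q : nat -> nat -> R}
    {w : word R} :
  tableau_of n P w -> tableau_of n Q w -> forall i a, P i a = Q i a.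
Proof.
move=> tP tQ; have [[cP _] _] := tP; have [[cQ _] _] := tQ => i a.
have [k [rE P0 _]] := tableau_of_rows tP.
have [k' [rE' Q0 _]] := tableau_of_rows tQ.
have kk : k = k' by have := congr1 size rE; rewrite rE' !size_mkseq.
have [ik|ki] := ltnP i k; last first.
  by rewrite (is_row_eq0 (cP i)) ?P0 // (is_row_eq0 (cQ i)) ?Q0 -?kk.
have := congr1 (nth (wempty R) ^~ i) rE; rewrite rE' /= !nth_mkseq -?kk // => E.
apply: (is_row_cumulative_inj (is_row_row_of (cP i))).
by rewrite -E; exact: is_row_row_of.
Qed.

(** [insert_rows] consumes the rows from the front while [carried] unfolds from the back; this
    reconciles the two recursions. *)
Lemma carried_shift {R : realType} (P : nat -> nat -> R) (V : nat -> R) (i : nat) :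
  carried P V i.+1 = carried (fun j => P j.+1) (bumped (P 0%N) V) i.
Proof. by elim: i => // i IH; rewrite [LHS]/= -/(carried P V i.+1) IH. Qed.

Lemma size_insert_rows {R : realType} (us : seq (word R)) (v : word R) :
  size (insert_rows us v) = (size us).+1.
Proof. by elim: us v => //= u us IH v; rewrite IH. Qed.

Lemma is_row_insert_rows {R : realType} {n : nat} {P : nat -> nat -> R}
    {V : nat -> R} {us : seq (word R)} {v : word R} :
  (forall i, (i < size us)%N -> is_row n (P i) (nth (wempty R) us i)) ->
  is_row n V v ->
  forall i, (i <= size us)%N ->
    is_row n (if (i < size us)%N then insertion P V i else carried P V i)
      (nth (wempty R) (insert_rows us v) i).
Proof.
elim: us P V v => [|u us IH] P V v rP rV [|i] //= ius.
  exact: (is_row_RINS (rP 0%N isT) rV).2.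
rewrite /insertion -/(carried P V i.+1) carried_shift ltnS.
apply: (IH (fun j => P j.+1)) => [j jus||//]; first exact: (rP j.+1).
exact: (is_row_RINS (rP 0%N isT) rV).1.
Qed.

Lemma tableau_of_INSERT {R : realType} {n : nat} {P : nat -> nat -> R}
    {V : nat -> R} {w v : word R} :
  tableau_of n P w -> is_row n V v ->
  tableau_of n (insertion P V) (INSERT n w v).
Proof.
move=> tP rV; have [pP _] := tP; have cV := is_row_cumulative rV.
have [cP _] := pP; have pQ := insertion_pattern pP cV; have [cQ _] := pQ.
have [k [rE P0 _]] := tableau_of_rows tP.
have P00 i : (k <= i)%N -> forall a, P i a = 0.
  by move=> ki; apply: is_row_eq0 => //; exact: P0.
have carried0 i : (k < i)%N -> forall a, carried P V i a = 0.
  by case: i => // i ki a; apply: (carried_eq0 _ _ pP cV); exact: P00.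
(* [INSERT] appends the last bumped word as row [k]; the pattern inserts it into the empty row [k],
   with the same result. *)
have QE i : (k <= i)%N -> forall a, insertion P V i a = carried P V i a.
  move=> ki a; have := carried0 i.+1 ki a.
  by rewrite /= /bumped -/(insertion P V i) P00 //; lra.
split=> //; exists k.+1 => [i ki|].
  by rewrite QE ?carried0 // ltnW.
rewrite /INSERT /rows_word rE; congr (wprod (rev _)).
apply: (@eq_from_nth _ (wempty R)); first by rewrite size_insert_rows !size_mkseq.
move=> i; rewrite size_insert_rows size_mkseq => ik; rewrite nth_mkseq //.
apply: is_row_inj (is_row_row_of (cQ i)).
have := @is_row_insert_rows _ n P V (mkseq (fun i => row_of n (P i)) k) v.
rewrite size_mkseq => /(_ _ rV i ik) h.
have {h} : is_row n (if (i < k)%N then insertion P V i else carried P V i)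
   (nth (wempty R) (insert_rows (mkseq (fun i => row_of n (P i)) k) v) i).
  by apply: h => j jk; rewrite nth_mkseq //; exact: is_row_row_of.
case: ltnP => // ki; apply: is_row_ext => a.
by rewrite QE.
Qed.

(** * The bijection *)

Lemma psum_nth {R : realType} (la : seq R) (N : nat) :
  (size la <= N)%N -> psum la = \sum_(i < N) nth 0 la i.
Proof.
move=> laN; rewrite /psum (big_nth 0) big_mkord (big_ord_widen _ (nth 0 la) laN).
rewrite big_mkcond; apply: eq_bigr => i _.
by case: ltnP => // ?; rewrite nth_default.
Qed.

Lemma psum_insertion {R : realType} {n : nat} {P : nat -> nat -> R}
    {V : nat -> R} {w v : word R} {la mu : seq R} :
  tableau_of n P w -> is_row n V v -> (forall i, P i n = nth 0 la i) ->
  (forall i, insertion P V i n = nth 0 mu i) -> psum la + V n = psum mu.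
Proof.
move=> [pP [N P0 _]] rV Pla Qmu; have cV := is_row_cumulative rV.
(* Row [M] is empty, so nothing is carried out of the first [M.+1] rows and the balance of lengths
   is exact. *)
pose M := maxn N (maxn (size la) (size mu)).
rewrite (@psum_nth _ la M.+1) 1?(@psum_nth _ mu M.+1); [|lia|lia].
under eq_bigr => i _ do rewrite -Pla.
under [in RHS]eq_bigr => i _ do rewrite -Qmu.
rewrite sum_insertion (carried_eq0 _ _ pP cV) ?subr0 // => a.
by have [cP _] := pP; apply: (is_row_eq0 (cP M)); apply: P0; lia.
Qed.

Lemma tableauxP {R : realType} {n : nat} {la : seq R} {w : word R} :
  tableaux n la w <->
  exists2 P, tableau_of n P w & forall i, P i n = nth 0 la i.
Proof.
split=> [[tw sw]|[P tP Pla]].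
  have [P tP] := timed_tableau_tableau_of tw; exists P => // i.
  by rewrite -sw (nth_shape_tableau_of _ tP).
have [k [_ _ tw]] := tableau_of_rows tP.
by split=> // i; rewrite (nth_shape_tableau_of _ tP) Pla.
Qed.

Theorem theorem2p22 (R : realType) (n : nat) (la : seq R) (r : R)
    (hla : real_partition la) (hr : 0 <= r) :
  set_bij (tableaux n la `*` timed_rows n r)
    (\bigcup_(mu in [set mu : seq R |
        [/\ real_partition mu, interleaves la mu & psum la + r = psum mu]])
      tableaux n mu)
    (fun p : word R * word R => INSERT n p.1 p.2).
Proof.
split.
- move=> [w v] [/= /tableauxP[P tP Pla] [/timed_row_is_row[V rV] vr]].
  have tQ := tableau_of_INSERT tP rV; have [pQ [N Q0 _]] := tQ.
  have [pP _] := tP; have cV := is_row_cumulative rV; have [cQ _] := pQ.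
  (* The shape is cut after [N] rows, beyond which the inserted pattern vanishes. *)
  pose mu := mkseq (fun i => insertion P V i n) N.
  have Qmu i : insertion P V i n = nth 0 mu i.
    have [iN|Ni] := ltnP i N; first by rewrite nth_mkseq.
    by rewrite nth_default ?size_mkseq // Q0.
  exists mu; last by apply/tableauxP; exists (insertion P V).
  split.
  + split; last by apply/allP => _ /mapP[i _ ->]; exact: cumulative_ge0 (cQ i).
    by apply/(sortedP 0) => i _; rewrite -!Qmu; exact: (pattern_le_rows _ _ pQ).
  + by move=> i; rewrite -!Qmu -Pla (insertion_interlace _ _ pP cV).
  + rewrite -(psum_insertion tP rV Pla Qmu).
    by have [_ <- _ _] := rV; rewrite vr.
- move=> [w v] [w' v'].
  move=> /set_mem[/= /tableauxP[P tP Pla] [/timed_row_is_row[V rV] _]].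
  move=> /set_mem[/= /tableauxP[P' tP' Pla'] [/timed_row_is_row[V' rV'] _]] E.
  have tQ := tableau_of_INSERT tP rV; have tQ' := tableau_of_INSERT tP' rV'.
  rewrite E in tQ; have QE := tableau_of_pattern_inj tQ tQ'.
  have [|PE VE] := insertion_inj tP.1 (is_row_cumulative rV) tP'.1
    (is_row_cumulative rV') _ QE; first by move=> i; rewrite Pla Pla'.
  have {}PE : P = P' by apply/funext => i; apply/funext.
  rewrite -PE in tP'; rewrite (tableau_of_inj tP tP').
  by rewrite (is_row_inj (is_row_ext VE rV) rV').
- move=> w [mu [_ lamu smu] /tableauxP[Q tQ Qmu]].
  have [|P [V [pP cV Pla QE]]] := @insertion_surj _ n Q (nth 0 la) tQ.1.
    by move=> i; rewrite !Qmu.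
  have {}QE : insertion P V = Q by apply/funext => i; apply/funext.
  have rV := is_row_row_of cV.
  have tP : tableau_of n P (rows_word n P (size la)).
    by split=> //; exists (size la) => // i lai; rewrite Pla nth_default.
  have tw := tableau_of_INSERT tP rV; rewrite QE in tw.
  exists (rows_word n P (size la), row_of n V); last exact: tableau_of_inj tw tQ.
  split=> /=; first by apply/tableauxP; exists P.
  split; first exact: is_row_timed_row rV.
  have Qmu' i : insertion P V i n = nth 0 mu i by rewrite QE Qmu.
  (* The recovered row has length [r] because total lengths are preserved. *)
  have := psum_insertion tP rV Pla Qmu'; rewrite -smu /=.
  exact: addrI.
Qed.
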